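(* Let $z\in\mathbb{C}$, let $s\ge 2$ be an integer and $a$ a parameter for which $\Phi(z,s,a)$ is defined. If the integral converges, then \[ \frac{(s-2)(-1)^s}{s}\,\Phi(z,s,a)\,\Gamma(s)=\int_0^1\!\!\int_0^1\frac{(xy)^{a-1}}{(1-zxy)\log(xy)}\sum_{k=1}^{s-2}\binom{s-1}{k}\log^k(x)\log^{s-k-1}(y)\,dx\,dy. \]
   Context: The Lerch transcendent is $\Phi(z,s,a)=\sum_{k=0}^\infty \frac{z^k}{(k+a)^s}$ (where this series converges); $\Gamma$ is Euler's gamma function. *)

(* Defs.v *)
From Stdlib Require Import Reals.
From Coquelicot Require Import Coquelicot.
Open Scope R_scope.

Definition cexp (w : C) : C :=
  (exp (Re w) * cos (Im w), exp (Re w) * sin (Im w)).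

Definition rcpow (t : R) (w : C) : C := cexp (w * RtoC (ln t)).

Fixpoint cpown (w : C) (n : nat) : C :=
  match n with O => 1%C | S m => (w * cpown w m)%C end.

Definition lerch_term (z : C) (s : nat) (a : C) (k : nat) : C :=
  (cpown z k / cpown (RtoC (INR k) + a) s)%C.

(* Lerch transcendent Phi(z,s,a) = sum_{k>=0} z^k/(k+a)^s
   (meaningful when the series converges, i.e. ex_series (lerch_term z s a)) *)
Definition LerchPhi (z : C) (s : nat) (a : C) : C :=
  (Series (fun k => Re (lerch_term z s a k)),
   Series (fun k => Im (lerch_term z s a k))).

Definition Gamma (s : R) : R :=
  RInt_gen (fun t => Rpower t (s - 1) * exp (- t)) (at_right 0) (Rbar_locally p_infty).

Definition integrand34 (z : C) (s : nat) (a : C) (x y : R) : C :=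
  (rcpow (x * y) (a - 1)
   / ((1 - z * RtoC (x * y)) * RtoC (ln (x * y)))
   * RtoC (sum_n_m (fun k : nat => Binomial.C (s - 1) k * ln x ^ k * ln y ^ (s - k - 1))%R
                   1 (s - 2)))%C.

(* Main.v *)
(** With [u = - ln x], [v = - ln y] the integrand becomes [(-1)^s F_0(u+v)] times
    [sum_k C(s-1,k) u^k v^(s-1-k)], where [F_0(w) = exp(-a w) / ((1 - z exp(-w)) w)].  Let
    [F_(j+1)] be the primitive [int_v^oo F_j].  Repeated integration by parts turns the inner
    integral of [u^k F_0(u+v)] into [k! F_(k+1)(v)] and the outer one of [v^(s-1-k) F_(k+1)(v)]
    into [(s-1-k)! F_(s+1)(0+)], so each of the [s-2] terms contributes [(s-1)! F_(s+1)(0+)] and no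
    Fubini theorem is needed.  The iterated primitives of [w F_0(w)] are explicit,
    [G_j(v) = sum_k z^k exp(-(k+a)v) / (k+a)^j], and [G_j(v) = v F_j(v) + j F_(j+1)(v)]; with [j = s]
    and [v -> 0+], Abel's theorem gives [F_(s+1)(0+) = Phi(z,s,a) / s].

    This needs [|z| <= 1], which convergence of the series forces by d'Alembert's test, and
    [Re a > 0], which convergence of the inner integral forces as soon as [s >= 3]. *)

Require Import Defs.
From Stdlib Require Import Reals Lra Lia Factorial.
From Coquelicot Require Import Coquelicot.
Open Scope R_scope.

(** * Improper integrals on the unit interval *)

(** The integral is given in iterated form, so every step concerns a real improper integral in one
    variable whose value is then identified by uniqueness. Complex quantities are split into real
    and imaginary part, and one real statement about towers of primitives serves both.

    The obstacle is the endpoint [0] of the outer integral. At [z = 1] the function [F_0(w)] behaves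
    like [w^(-2)], and the estimate used for each [F_(j+1)] blows up like [1 / v]. The boundary
    terms of the outer integration by parts are [v^i F_(s+1-i)(v)]. The estimate disposes of those
    with [i >= 2] but not of [v F_s(v)]; there the identity [G_(s-1) = v F_(s-1) + (s-1) F_s] is
    multiplied by [v], and [G_(s-1)] has a limit at [0+] because [s - 1 >= 2] makes its series
    absolutely convergent.

    The case [s = 2] stands apart: the sum over [k] is empty, both sides vanish, and nothing about
    [Re a] can be inferred. *)

Lemma is_RInt_gen_antiderivative (D : R -> Prop) (Fa Fb : (R -> Prop) -> Prop)
  {FFa : Filter Fa} {FFb : Filter Fb} (A f : R -> R) (la lb : R) :
  (forall x y t, D x -> D y -> x <= t <= y -> D t) ->
  Fa D -> Fb D ->
  (forall x, D x -> is_derive A x (f x)) ->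
  (forall x, D x -> continuous f x) ->
  filterlim A Fa (locally la) -> filterlim A Fb (locally lb) ->
  is_RInt_gen f Fa Fb (lb - la).
Proof.
intros HD Ha Hb dA cf La Lb.
assert (HD' : forall x y t, D x -> D y -> Rmin x y <= t <= Rmax x y -> D t).
{ intros x y t Dx Dy; unfold Rmin, Rmax.
  destruct (Rle_dec x y); intros Ht; [apply (HD x y) | apply (HD y x)]; easy. }
unfold is_RInt_gen.
apply (filterlimi_lim_ext_loc (fun ab => minus (A (snd ab)) (A (fst ab)))).
- apply (Filter_prod _ _ _ D D Ha Hb); intros x y Dx Dy; simpl.
  apply (is_RInt_derive A f); intros t Ht.
  + apply dA, (HD' x y); assumption.
  + apply cf, (HD' x y); assumption.
- replace (lb - la) with (plus lb (opp la)) by reflexivity.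
  apply (filterlim_comp_2 (G := locally lb) (H := locally (opp la)) (fun ab : R * R => A (snd ab)) (fun ab : R * R => opp (A (fst ab))) plus).
  + exact (filterlim_comp _ _ _ snd A _ _ _ filterlim_snd Lb).
  + apply (filterlim_comp _ _ _ (fun ab : R * R => A (fst ab)) opp _ (locally la)).
    * exact (filterlim_comp _ _ _ fst A _ _ _ filterlim_fst La).
    * apply (filterlim_opp la).
  + apply (filterlim_plus lb (opp la)).
Qed.

Lemma filterlim_opp_ln_0 :
  filterlim (fun x => - ln x) (at_right 0) (Rbar_locally p_infty).
Proof.
apply (filterlim_comp _ _ _ ln Ropp _ (Rbar_locally m_infty)).
- exact is_lim_ln_0.
- exact (filterlim_Rbar_opp m_infty).
Qed.

Lemma filterlim_opp_ln_1 :
  filterlim (fun x => - ln x) (at_left 1) (at_right 0).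
Proof.
intros P [d Hd].
assert (Hc : continuous ln 1) by (apply (ex_derive_continuous (V := R_NormedModule)); auto_derive; lra).
destruct (proj1 (filterlim_locally ln (ln 1)) Hc d) as [e He].
assert (He' : 0 < Rmin e 1) by (apply Rmin_glb_lt; [apply cond_pos | lra]).
exists (mkposreal _ He'); intros x Hx Hx1.
assert (Hb : Rabs (x - 1) < Rmin e 1) by exact Hx.
assert (x > 0).
{ pose proof (Rmin_r e 1); apply Rabs_def2 in Hb; lra. }
assert (Hln : Rabs (ln x - ln 1) < d).
{ apply He; change (Rabs (x - 1) < e); pose proof (Rmin_l e 1); lra. }
rewrite ln_1 in Hln.
assert (ln x < 0) by (rewrite <- ln_1; apply ln_increasing; lra).
apply Hd; [| lra].
change (Rabs (- ln x - 0) < d).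
rewrite <- Rabs_Ropp; replace (- (- ln x - 0)) with (ln x - 0) by ring; exact Hln.
Qed.

Lemma opp_ln_pos x : 0 < x < 1 -> 0 < - ln x.
Proof.
intros Hx; assert (ln x < ln 1) by (apply ln_increasing; lra); rewrite ln_1 in *; lra.
Qed.

Lemma at_right_0_unit : at_right 0 (fun x => 0 < x < 1).
Proof.
exists (mkposreal 1 Rlt_0_1); intros x Hx H0.
change (Rabs (x - 0) < 1) in Hx; apply Rabs_def2 in Hx; lra.
Qed.

Lemma at_left_1_unit : at_left 1 (fun x => 0 < x < 1).
Proof.
exists (mkposreal 1 Rlt_0_1); intros x Hx H0.
change (Rabs (x - 1) < 1) in Hx; apply Rabs_def2 in Hx; lra.
Qed.

(** The substitution [u = - ln x] is carried out on the primitive: [- T (- ln x)] has derivative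
    [h (- ln x) / x]. The end [x = 0] corresponds to [u] at infinity, where [T] vanishes, so only
    the limit of [T] at [u = 0] contributes. *)
Lemma is_RInt_gen_opp_ln (T h : R -> R) (L : R) :
  (forall u, 0 < u -> is_derive T u (h u)) ->
  (forall u, 0 < u -> continuous h u) ->
  filterlim T (Rbar_locally p_infty) (locally 0) ->
  filterlim T (at_right 0) (locally L) ->
  is_RInt_gen (fun x => / x * h (- ln x)) (at_right 0) (at_left 1) (- L).
Proof.
intros dT ch Li L0.
replace (- L) with (opp L - opp 0) by (unfold opp; simpl; ring).
apply (is_RInt_gen_antiderivative (fun x => 0 < x < 1) _ _ (fun x => opp (T (- ln x)))).
- intros; lra.
- exact at_right_0_unit.
- exact at_left_1_unit.
- intros x Hx.
  assert (Hd : is_derive (fun x => T (- ln x)) x (scal (- / x) (h (- ln x)))).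
  { apply (is_derive_comp T (fun x => - ln x)).
    - now apply dT, opp_ln_pos.
    - auto_derive; [lra | field; lra]. }
  apply is_derive_opp in Hd.
  replace (/ x * h (- ln x)) with (opp (scal (- / x) (h (- ln x)))); [exact Hd |].
  unfold opp, scal; simpl; unfold mult; simpl; ring.
- intros x Hx.
  apply (continuous_mult (K := R_AbsRing) Rinv).
  + apply (ex_derive_continuous (V := R_NormedModule)); auto_derive; lra.
  + apply continuous_comp.
    * apply (ex_derive_continuous (V := R_NormedModule)); auto_derive; lra.
    * now apply ch, opp_ln_pos.
- apply (filterlim_comp _ _ _ (fun x => T (- ln x)) opp _ (locally 0)).
  + exact (filterlim_comp _ _ _ (fun x => - ln x) T _ _ _ filterlim_opp_ln_0 Li).
  + apply (filterlim_opp (V := R_NormedModule)).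
- apply (filterlim_comp _ _ _ (fun x => T (- ln x)) opp _ (locally L)).
  + exact (filterlim_comp _ _ _ (fun x => - ln x) T _ _ _ filterlim_opp_ln_1 L0).
  + apply (filterlim_opp (V := R_NormedModule)).
Qed.

(** * Repeated integration by parts *)

Lemma filterlim_Rplus {T} (F : (T -> Prop) -> Prop) {FF : Filter F} (f g : T -> R) a b :
  filterlim f F (locally a) -> filterlim g F (locally b) ->
  filterlim (fun x => f x + g x) F (locally (a + b)).
Proof.
intros Hf Hg.
apply (filterlim_comp_2 (G := locally a) (H := locally b) f g Rplus); [assumption | assumption |].
apply (filterlim_plus (V := R_NormedModule) a b).
Qed.

Lemma filterlim_Rmult {T} (F : (T -> Prop) -> Prop) {FF : Filter F} (f g : T -> R) a b :
  filterlim f F (locally a) -> filterlim g F (locally b) ->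
  filterlim (fun x => f x * g x) F (locally (a * b)).
Proof.
intros Hf Hg.
apply (filterlim_comp_2 (G := locally a) (H := locally b) f g Rmult); [assumption | assumption |].
apply (filterlim_mult (K := R_AbsRing) a b).
Qed.

Lemma filterlim_Rscal {T} (F : (T -> Prop) -> Prop) {FF : Filter F} (f : T -> R) k a :
  filterlim f F (locally a) -> filterlim (fun x => k * f x) F (locally (k * a)).
Proof.
intros Hf; apply (filterlim_Rmult F); [apply filterlim_const | assumption].
Qed.

Lemma filterlim_Rabs_le {T} (F : (T -> Prop) -> Prop) {FF : Filter F} (f g : T -> R) :
  F (fun x => Rabs (f x) <= g x) -> filterlim g F (locally 0) -> filterlim f F (locally 0).
Proof.
intros Hle Hg.
apply filterlim_locally; intros eps.
generalize (filter_and _ _ Hle (proj1 (filterlim_locally g 0) Hg eps)).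
apply filter_imp; intros x [H1 H2].
change (Rabs (g x - 0) < eps) in H2; change (Rabs (f x - 0) < eps).
rewrite Rminus_0_r in *; pose proof (Rle_abs (g x)); lra.
Qed.

Lemma continuous_at_right (f : R -> R) x : continuous f x -> filterlim f (at_right x) (locally (f x)).
Proof.
intros Hf; apply (filterlim_filter_le_1 (F := locally x)); [| exact Hf].
apply filter_le_within.
Qed.

Lemma at_right_gt x : at_right x (fun u => x < u).
Proof. now exists (mkposreal 1 Rlt_0_1). Qed.

(* A primitive of [u ^ k * F j (u + c)] whenever [F (S j)] is a primitive of [- F j]. *)
Fixpoint by_parts (F : nat -> R -> R) (c : R) (k j : nat) (u : R) : R :=
  match k with
  | O => - F (S j) (u + c)
  | S k' => - (u ^ k * F (S j) (u + c)) + INR k * by_parts F c k' (S j) u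
  end.

(** The minus sign is that of the primitive taken from [v] to infinity. Vanishing at infinity is
    kept apart, as [rapid_decay], and no behaviour at [0] is prescribed, since the functions of
    interest may be singular there. *)
Definition primitive_tower (F : nat -> R -> R) : Prop :=
  (forall j v, 0 < v -> is_derive (F (S j)) v (- F j v)) /\
  (forall v, 0 < v -> continuous (F O) v).

Lemma primitive_tower_continuous F j v :
  primitive_tower F -> 0 < v -> continuous (F j) v.
Proof.
intros [HD HC] Hv; destruct j; [now apply HC |].
apply (ex_derive_continuous (V := R_NormedModule)); eexists; now apply HD.
Qed.

Lemma is_derive_by_parts F c k j u :
  primitive_tower F -> 0 < u + c ->
  is_derive (by_parts F c k j) u (u ^ k * F j (u + c)).
Proof.
intros HF Hu.
assert (HS : forall i, is_derive (fun u => F (S i) (u + c)) u (- F i (u + c))).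
{ intros i; evar_last.
  - apply (is_derive_comp (F (S i)) (fun u => u + c)); [now apply HF |].
    auto_derive; [trivial | reflexivity].
  - unfold scal; simpl; unfold mult; simpl; ring. }
revert j; induction k as [|k IH]; intros j.
- evar_last; [apply (is_derive_opp (fun u => F (S j) (u + c))), HS |].
  unfold opp; simpl; ring.
- evar_last.
  + apply (is_derive_plus (fun u => - (u ^ S k * F (S j) (u + c)))
             (fun u => INR (S k) * by_parts F c k (S j) u)).
    * apply (is_derive_opp (fun u => u ^ S k * F (S j) (u + c))).
      apply (is_derive_mult (fun u => u ^ S k)); [| apply HS | exact Rmult_comm].
      apply (is_derive_pow (fun u => u)); apply is_derive_id.
    * apply is_derive_scal, IH.
  + unfold opp, plus, one; simpl; unfold mult, plus, one; simpl pred.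
    simpl; ring.
Qed.

Lemma by_parts_0 F c k j : by_parts F c k j 0 = - (INR (fact k) * F (j + k + 1)%nat c).
Proof.
revert j; induction k as [|k IH]; intros j.
- simpl; rewrite Rplus_0_l, Nat.add_0_r, Nat.add_1_r; ring.
- change (by_parts F c (S k) j 0) with
    (- (0 ^ S k * F (S j) (0 + c)) + INR (S k) * by_parts F c k (S j) 0).
  rewrite IH, fact_simpl, mult_INR.
  replace (S j + k + 1)%nat with (j + S k + 1)%nat by lia.
  rewrite pow_i by lia; ring.
Qed.

(** With shift [0] the tower is approached at its singularity, so the powers of [u] no longer kill
    the boundary terms by themselves: their vanishing is a hypothesis, level by level, and only the
    last term keeps a nonzero limit. *)
Lemma filterlim_by_parts_0 F m j L :
  (forall i, (1 <= i <= m)%nat ->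
    filterlim (fun u => u ^ i * F (j + m + 1 - i)%nat u) (at_right 0) (locally 0)) ->
  filterlim (F (j + m + 1)%nat) (at_right 0) (locally L) ->
  filterlim (by_parts F 0 m j) (at_right 0) (locally (- (INR (fact m) * L))).
Proof.
revert j; induction m as [|m IH]; intros j H0 HL.
- apply (filterlim_ext (fun u => -1 * F (j + 0 + 1)%nat u)).
  + intros u; simpl; rewrite Rplus_0_r, Nat.add_0_r, Nat.add_1_r; ring.
  + simpl fact; simpl INR; replace (- (1 * L)) with (-1 * L) by ring.
    now apply filterlim_Rscal; [apply at_right_proper_filter |].
- apply (filterlim_ext (fun u => -1 * (u ^ S m * F (j + S m + 1 - S m)%nat u)
     + INR (S m) * by_parts F 0 m (S j) u)).
  + intros u.
    change (by_parts F 0 (S m) j u) with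
      (- (u ^ S m * F (S j) (u + 0)) + INR (S m) * by_parts F 0 m (S j) u).
    replace (j + S m + 1 - S m)%nat with (S j) by lia.
    rewrite Rplus_0_r; ring.
  + replace (- (INR (fact (S m)) * L)) with (-1 * 0 + INR (S m) * (- (INR (fact m) * L))).
    2:{ rewrite fact_simpl, mult_INR; ring. }
    apply filterlim_Rplus; [apply at_right_proper_filter | |].
    * apply filterlim_Rscal; [apply at_right_proper_filter |]; apply H0; lia.
    * apply filterlim_Rscal; [apply at_right_proper_filter |]; apply IH.
      -- intros i Hi; replace (S j + m + 1)%nat with (j + S m + 1)%nat by lia; apply H0; lia.
      -- now replace (S j + m + 1)%nat with (j + S m + 1)%nat by lia.
Qed.

Definition rapid_decay (f : R -> R) : Prop :=
  forall i, filterlim (fun w => w ^ i * f w) (Rbar_locally p_infty) (locally 0).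

(** Since [c >= 0], [u^i] is at most [(u + c)^i], so each term is controlled by the decay of the
    tower in the variable [u + c]. *)
Lemma filterlim_by_parts_infty F c k j :
  0 <= c -> (forall i, rapid_decay (F (S i))) ->
  filterlim (by_parts F c k j) (Rbar_locally p_infty) (locally 0).
Proof.
intros Hc HF.
assert (HS : forall i l, filterlim (fun u => u ^ i * F (S l) (u + c)) (Rbar_locally p_infty) (locally 0)).
{ intros i l.
  apply (filterlim_Rabs_le _ _ (fun u => Rabs ((u + c) ^ i * F (S l) (u + c)))).
  - exists 0; intros u Hu; rewrite !Rabs_mult.
    apply Rmult_le_compat_r; [apply Rabs_pos |].
    rewrite <- !RPow_abs; apply pow_incr; split; [apply Rabs_pos |].
    rewrite !Rabs_pos_eq; lra.
  - apply (filterlim_comp _ _ _ (fun u => u + c) (fun w => Rabs (w ^ i * F (S l) w)) _ (Rbar_locally p_infty)).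
    + intros P [M HM]; exists M; intros u Hu; apply HM; lra.
    + apply (filterlim_comp _ _ _ (fun w => w ^ i * F (S l) w) Rabs _ (locally 0)); [apply HF |].
      generalize (continuous_Rabs 0); unfold continuous; now rewrite Rabs_R0. }
revert j; induction k as [|k IH]; intros j.
- apply (filterlim_ext (fun u => -1 * (u ^ 0 * F (S j) (u + c)))).
  + intros u; simpl; ring.
  + replace 0 with (-1 * 0) at 1 by ring. apply filterlim_Rscal; [apply Rbar_locally_filter | apply HS].
- apply (filterlim_ext (fun u => -1 * (u ^ S k * F (S j) (u + c)) + INR (S k) * by_parts F c k (S j) u)).
  + intros u; change (by_parts F c (S k) j u) with
      (- (u ^ S k * F (S j) (u + c)) + INR (S k) * by_parts F c k (S j) u); ring.
  + replace 0 with (-1 * 0 + INR (S k) * 0) at 1 by ring.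
    apply filterlim_Rplus; [apply Rbar_locally_filter | |];
    apply filterlim_Rscal; try apply Rbar_locally_filter; [apply HS | apply IH].
Qed.

Lemma continuous_pow_shift F c k j u :
  primitive_tower F -> 0 < u + c -> continuous (fun u => u ^ k * F j (u + c)) u.
Proof.
intros HF Hu.
apply (continuous_mult (K := R_AbsRing) (fun u => u ^ k)).
- apply (ex_derive_continuous (V := R_NormedModule)); auto_derive; trivial.
- apply (continuous_comp (fun u => u + c) (F j)).
  + apply (ex_derive_continuous (V := R_NormedModule)); auto_derive; trivial.
  + now apply primitive_tower_continuous.
Qed.

(** Here [c > 0] keeps the argument of the tower away from [0], so the primitive is continuous at
    [u = 0] and its limit there is simply its value. *)
Lemma is_RInt_gen_inner F c k :
  primitive_tower F -> (forall i, rapid_decay (F (S i))) -> 0 < c ->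
  is_RInt_gen (fun x => / x * ((- ln x) ^ k * F O (- ln x + c))) (at_right 0) (at_left 1)
    (INR (fact k) * F (S k) c).
Proof.
intros HF Hinf Hc.
replace (INR (fact k) * F (S k) c) with (- by_parts F c k 0 0).
2:{ rewrite by_parts_0, Nat.add_1_r; simpl; ring. }
apply (is_RInt_gen_opp_ln (by_parts F c k 0) (fun u => u ^ k * F O (u + c))).
- intros u Hu; apply is_derive_by_parts; [assumption | lra].
- intros u Hu; apply continuous_pow_shift; [assumption | lra].
- apply filterlim_by_parts_infty; [lra | assumption].
- apply continuous_at_right, (ex_derive_continuous (V := R_NormedModule)).
  eexists; apply is_derive_by_parts; [assumption | lra].
Qed.

Lemma is_RInt_gen_outer F m j L :
  primitive_tower F -> (forall i, rapid_decay (F (S i))) ->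
  (forall i, (1 <= i <= m)%nat ->
    filterlim (fun u => u ^ i * F (j + m + 1 - i)%nat u) (at_right 0) (locally 0)) ->
  filterlim (F (j + m + 1)%nat) (at_right 0) (locally L) ->
  is_RInt_gen (fun y => / y * ((- ln y) ^ m * F j (- ln y))) (at_right 0) (at_left 1)
    (INR (fact m) * L).
Proof.
intros HF Hinf H0 HL.
replace (INR (fact m) * L) with (- - (INR (fact m) * L)) by ring.
apply (is_RInt_gen_opp_ln (by_parts F 0 m j) (fun u => u ^ m * F j u)).
- intros u Hu; rewrite <- (Rplus_0_r u) at 3; apply is_derive_by_parts; [assumption | lra].
- intros u Hu. apply (continuous_ext (fun u => u ^ m * F j (u + 0))).
  + intros t; now rewrite Rplus_0_r.
  + apply continuous_pow_shift; [assumption | lra].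
- apply filterlim_by_parts_infty; [lra | assumption].
- now apply filterlim_by_parts_0.
Qed.

(** * Primitives of [G 0 v / v] *)

(** The exponential is the modulus of [exp (- a v)] for [al = Re a]; the factor [1 + / v] dominates
    [1 / (1 - exp (- v))], which bounds the geometric series uniformly in [|z| <= 1]. *)
Definition decay_bound (al v : R) : R := exp (- (al * v)) * (1 + / v).

Lemma is_derive_decay_bound al v : 0 < v ->
  is_derive (decay_bound al) v (- (exp (- (al * v)) * (al + al / v + / v ^ 2))).
Proof.
intros Hv; unfold decay_bound; auto_derive; [lra | field; lra].
Qed.

Lemma decay_bound_pos al v : 0 < v -> 0 < decay_bound al v.
Proof.
intros Hv; apply Rmult_lt_0_compat; [apply exp_pos |].
pose proof (Rinv_0_lt_compat v Hv); lra.
Qed.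

(** Induction with the rate halved: [w^(i+1) exp (- al w)] is the product of [w^i exp (- al w / 2)]
    and [w exp (- al w / 2)]. *)
Lemma filterlim_pow_exp al i : 0 < al ->
  filterlim (fun w => w ^ i * exp (- (al * w))) (Rbar_locally p_infty) (locally 0).
Proof.
assert (Hm : forall be, 0 < be -> filterlim (fun w => - (be * w)) (Rbar_locally p_infty) (Rbar_locally m_infty)).
{ intros be Hbe P [M HM]; exists (- M / be); intros w Hw; apply HM.
  apply (Rmult_lt_compat_l be) in Hw; [| assumption].
  replace (be * (- M / be)) with (- M) in Hw by (field; lra); lra. }
revert al; induction i as [|i IH]; intros al Hal.
- apply (filterlim_ext (fun w => exp (- (al * w)))); [intros; simpl; ring |].
  apply (filterlim_comp _ _ _ (fun w => - (al * w)) exp _ (Rbar_locally m_infty)).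
  + now apply Hm.
  + exact is_lim_exp_m.
- apply (filterlim_ext (fun w => - / (al / 2) * ((w ^ i * exp (- (al / 2 * w))) *
      (- (al / 2 * w) * exp (- (al / 2 * w)))))).
  + intros w; replace (- (al * w)) with (- (al / 2 * w) + - (al / 2 * w)) by field.
    rewrite exp_plus; simpl; field; lra.
  + replace 0 with (- / (al / 2) * (0 * 0)) at 1 by ring.
    apply filterlim_Rscal; [apply Rbar_locally_filter |].
    apply filterlim_Rmult; [apply Rbar_locally_filter | apply IH; lra |].
    apply (filterlim_comp _ _ _ (fun w => - (al / 2 * w)) (fun y => y * exp y) _ (Rbar_locally m_infty)).
    * apply Hm; lra.
    * exact is_lim_mul_exp_m.
Qed.

Lemma nonincreasing_of_derive (f df : R -> R) a b : a <= b ->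
  (forall t, a <= t <= b -> is_derive f t (df t)) ->
  (forall t, a <= t <= b -> df t <= 0) -> f b <= f a.
Proof.
intros Hab Hd Hn.
destruct (MVT_gen f a b df) as [c [Hc Heq]].
- rewrite Rmin_left, Rmax_right by assumption; intros t Ht; apply Hd; lra.
- rewrite Rmin_left, Rmax_right by assumption; intros t Ht.
  apply continuity_pt_filterlim, (ex_derive_continuous (V := R_NormedModule)).
  eexists; now apply Hd.
- rewrite Rmin_left, Rmax_right in Hc by assumption.
  specialize (Hn c Hc); nra.
Qed.

Lemma rapid_decay_of_bound al K j f : 0 < al ->
  (forall v, 0 < v -> Rabs (f v) <= K * (1 + v) ^ j * decay_bound al v) ->
  rapid_decay f.
Proof.
intros Hal Hf i.
assert (HK : 0 <= K).
{ specialize (Hf 1 Rlt_0_1); pose proof (Rabs_pos (f 1)).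
  pose proof (decay_bound_pos al 1 Rlt_0_1).
  assert (0 < (1 + 1) ^ j) by (apply pow_lt; lra).
  apply Rnot_lt_le; intros HK.
  assert (0 < - K * (1 + 1) ^ j * decay_bound al 1) by (apply Rmult_lt_0_compat; [apply Rmult_lt_0_compat |]; lra).
  lra. }
(* For [w > 1] one has [1 + w <= 2 w] and [1 + / w <= 2], whence the factors [2 ^ j] and [2]. *)
apply (filterlim_Rabs_le _ _ (fun w => K * 2 ^ j * 2 * (w ^ (i + j) * exp (- (al * w))))).
- exists 1; intros w Hw.
  rewrite Rabs_mult, (Rabs_pos_eq (w ^ i)) by (apply pow_le; lra).
  apply Rle_trans with (w ^ i * (K * (2 * w) ^ j * (exp (- (al * w)) * 2))).
  + apply Rmult_le_compat_l; [apply pow_le; lra |].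
    apply Rle_trans with (1 := Hf w ltac:(lra)).
    assert (/ w <= 1) by (rewrite <- Rinv_1; apply Rinv_le_contravar; lra).
    apply Rmult_le_compat.
    * apply Rmult_le_pos; [assumption | apply pow_le; lra].
    * left; apply decay_bound_pos; lra.
    * apply Rmult_le_compat_l; [assumption | apply pow_incr; lra].
    * apply Rmult_le_compat_l; [left; apply exp_pos | lra].
  + rewrite pow_add, Rpow_mult_distr; right; ring.
- replace 0 with (K * 2 ^ j * 2 * 0) at 1 by ring.
  apply filterlim_Rscal; [apply Rbar_locally_filter | now apply filterlim_pow_exp].
Qed.

(** One power of [v] absorbs the [/ v] of [decay_bound]; [i >= 2] leaves at least one more, so the
    majorant is continuous and vanishes at [0]. *)
Lemma filterlim_at_right_0_of_bound al K j f i : 0 < al -> (2 <= i)%nat ->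
  (forall v, 0 < v -> Rabs (f v) <= K * (1 + v) ^ j * decay_bound al v) ->
  filterlim (fun v => v ^ i * f v) (at_right 0) (locally 0).
Proof.
intros Hal Hi Hf.
apply (filterlim_Rabs_le _ _ (fun v => K * (1 + v) ^ j * exp (- (al * v)) * (v ^ (i - 1) * (1 + v)))).
- apply (filter_imp (fun v => 0 < v)); [| apply at_right_gt].
  intros v Hv.
  rewrite Rabs_mult, (Rabs_pos_eq (v ^ i)) by (apply pow_le; lra).
  apply Rle_trans with (v ^ i * (K * (1 + v) ^ j * decay_bound al v)).
  + apply Rmult_le_compat_l; [apply pow_le; lra | now apply Hf].
  + replace (v ^ i) with (v * v ^ (i - 1)) by (rewrite tech_pow_Rmult; f_equal; lia).
    unfold decay_bound; right; field; lra.
- set (g := fun v => _).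
  replace 0 with (g 0) at 2.
  + apply continuous_at_right, (ex_derive_continuous (V := R_NormedModule)).
    unfold g; auto_derive; trivial.
  + unfold g; rewrite (pow_i (i - 1)) by lia; ring.
Qed.

(** A multiple [C * decay_bound] decreases at least as fast as [|f|]. Hence adding or subtracting
    the integral [A] of [f] from [1] leaves it nonincreasing, which bounds the increments of [A].
    They satisfy Cauchy's criterion at infinity; the function sought is the limit minus [A], and the
    same increments bound it. *)
Lemma primitive_vanishing_at_infinity al K (f : R -> R) : 0 < al ->
  (forall v, 0 < v -> continuous f v) ->
  (forall v, 0 < v -> Rabs (f v) <= K * decay_bound al v / v) ->
  exists F C, forall v, 0 < v -> is_derive F v (- f v) /\ Rabs (F v) <= C * decay_bound al v.
Proof.
intros Hal Hc Hb.
set (A := fun v => RInt f 1 v : R).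
assert (HA : forall v, 0 < v -> is_derive A v (f v)).
{ intros v Hv; apply (is_derive_RInt f A 1); [| now apply Hc].
  exists (mkposreal v Hv); intros w Hw; change (Rabs (w - v) < v) in Hw; apply Rabs_def2 in Hw.
  apply (RInt_correct f 1 w), (ex_RInt_continuous (V := R_CompleteNormedModule)); intros t Ht; apply Hc.
  assert (0 < Rmin 1 w) by (apply Rmin_glb_lt; lra); lra. }
assert (HK : 0 <= K).
{ specialize (Hb 1 Rlt_0_1); pose proof (Rabs_pos (f 1)).
  pose proof (decay_bound_pos al 1 Rlt_0_1); rewrite Rdiv_1_r in Hb.
  apply Rnot_lt_le; intros HK; nra. }
(* Chosen so that [(1 + / al) (al + al / v + / v^2)] dominates [/ v + / v^2]: the part [/ al] turns
   [al / v] into [/ v], and the part [1] covers [/ v^2]. *)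
set (C := K * (1 + / al)).
assert (Hial : 0 < / al) by now apply Rinv_0_lt_compat.
assert (HC : forall v, 0 < v ->
   Rabs (f v) <= C * (exp (- (al * v)) * (al + al / v + / v ^ 2))).
{ intros v Hv; apply Rle_trans with (1 := Hb v Hv); unfold decay_bound, C.
  assert (0 < / v) by now apply Rinv_0_lt_compat.
  replace (K * (exp (- (al * v)) * (1 + / v)) / v) with
    (K * exp (- (al * v)) * (/ v + / v * / v)) by (field; lra).
  replace (K * (1 + / al) * (exp (- (al * v)) * (al + al / v + / v ^ 2))) with
    (K * exp (- (al * v)) * ((al + 1) + (al * / v + / v) + (1 + / al) * (/ v * / v))) by (field; lra).
  apply Rmult_le_compat_l.
  - apply Rmult_le_pos; [assumption | left; apply exp_pos].
  - assert (0 < / v * / v) by now apply Rmult_lt_0_compat.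
    assert (0 < al * / v) by now apply Rmult_lt_0_compat.
    assert (0 < / al * (/ v * / v)) by now apply Rmult_lt_0_compat.
    lra. }
assert (Hdiff : forall v w, 0 < v -> v <= w ->
   Rabs (A w - A v) <= C * decay_bound al v - C * decay_bound al w).
{ intros v w Hv Hvw; apply Rabs_le; split.
  - enough (C * decay_bound al w - A w <= C * decay_bound al v - A v) by lra.
    apply (nonincreasing_of_derive (fun t => C * decay_bound al t - A t)
      (fun t => C * - (exp (- (al * t)) * (al + al / t + / t ^ 2)) - f t)); [assumption | |].
    + intros t Ht; apply (is_derive_minus (V := R_NormedModule) (fun t => C * decay_bound al t) A).
      * apply is_derive_scal, is_derive_decay_bound; lra.
      * apply HA; lra.
    + intros t Ht; specialize (HC t ltac:(lra)); pose proof (Rcomplements.Rabs_maj2 (f t)); lra.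
  - enough (C * decay_bound al w + A w <= C * decay_bound al v + A v) by lra.
    apply (nonincreasing_of_derive (fun t => C * decay_bound al t + A t)
      (fun t => C * - (exp (- (al * t)) * (al + al / t + / t ^ 2)) + f t)); [assumption | |].
    + intros t Ht; apply (is_derive_plus (V := R_NormedModule) (fun t => C * decay_bound al t) A).
      * apply is_derive_scal, is_derive_decay_bound; lra.
      * apply HA; lra.
    + intros t Ht; specialize (HC t ltac:(lra)); pose proof (Rle_abs (f t)); lra. }
assert (HC0 : 0 <= C) by (apply Rmult_le_pos; lra).
assert (HCB : forall v, 0 < v -> 0 <= C * decay_bound al v).
{ intros v Hv; apply Rmult_le_pos; [assumption | left; now apply decay_bound_pos]. }
assert (HB0 : filterlim (fun v => C * decay_bound al v) (Rbar_locally p_infty) (locally 0)).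
{ replace 0 with (C * 0) by ring; apply filterlim_Rscal; [apply Rbar_locally_filter |].
  apply (filterlim_ext (fun v => v ^ 0 * decay_bound al v)); [intros; simpl; ring |].
  apply (rapid_decay_of_bound al 1 0); [assumption |].
  intros v Hv; rewrite Rabs_pos_eq by (left; now apply decay_bound_pos); simpl; lra. }
destruct (proj1 (filterlim_locally_cauchy (U := R_CompleteSpace) (F := Rbar_locally p_infty) A)) as [L HL].
{ intros eps.
  exists (fun v => 0 < v /\ C * decay_bound al v < eps); split.
  - apply filter_and; [now exists 0 |].
    generalize (proj1 (filterlim_locally _ 0) HB0 eps); apply filter_imp; intros v Hv.
    change (Rabs (C * decay_bound al v - 0) < eps) in Hv; apply Rabs_def2 in Hv; lra.
  - intros u v [Hu Hu'] [Hv Hv']; change (Rabs (A v - A u) < eps).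
    destruct (Rle_dec u v) as [Huv | Huv].
    + apply Rle_lt_trans with (1 := Hdiff u v Hu Huv); specialize (HCB v Hv); lra.
    + rewrite Rabs_minus_sym.
      apply Rle_lt_trans with (1 := Hdiff v u Hv ltac:(lra)); specialize (HCB u Hu); lra. }
exists (fun v => L - A v), C; intros v Hv; split.
- replace (- f v) with (0 - f v) by ring.
  apply (is_derive_minus (V := R_NormedModule) (fun _ => L) A); [apply (is_derive_const (V := R_NormedModule)) | now apply HA].
- assert (Hev : Rbar_locally p_infty (fun w => A v - C * decay_bound al v <= A w <= A v + C * decay_bound al v)).
  { exists v; intros w Hw; specialize (Hdiff v w Hv ltac:(lra)); specialize (HCB w ltac:(lra)).
    apply Rabs_le_between in Hdiff; lra. }
  apply Rabs_le; split.
  + enough (Rbar_le (A v - C * decay_bound al v) L) by (simpl in *; lra).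
    apply (filterlim_le (F := Rbar_locally p_infty) (fun _ => A v - C * decay_bound al v) A).
    * revert Hev; apply filter_imp; tauto.
    * apply filterlim_const.
    * exact HL.
  + enough (Rbar_le L (A v + C * decay_bound al v)) by (simpl in *; lra).
    apply (filterlim_le (F := Rbar_locally p_infty) A (fun _ => A v + C * decay_bound al v)).
    * revert Hev; apply filter_imp; tauto.
    * exact HL.
    * apply filterlim_const.
Qed.

(* If [F] integrates [G 0 v / v] repeatedly from infinity and [G] integrates [G 0] in the
   same way, then [G j v = v * F j v + j * F (j + 1) v]; only [F 1] needs an actual integral. *)
Fixpoint quotient_tower (G : nat -> R -> R) (F1 : R -> R) (j : nat) (v : R) : R :=
  match j with
  | O => G O v / v
  | S i => match i with
           | O => F1 v
           | _ => (G i v - v * quotient_tower G F1 i v) / INR i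
           end
  end.

Lemma quotient_tower_SS G F1 j v : quotient_tower G F1 (S (S j)) v =
  (G (S j) v - v * quotient_tower G F1 (S j) v) / INR (S j).
Proof. reflexivity. Qed.

(** The derivative of [(G_(j+1) - v F_(j+1)) / (j+1)] is [(- G_j + v F_j - F_(j+1)) / (j+1)]. Since
    [G_j - v F_j = j F_(j+1)], this is [- F_(j+1)]. *)
Lemma primitive_tower_quotient G F1 : primitive_tower G ->
  (forall v, 0 < v -> is_derive F1 v (- (G O v / v))) ->
  primitive_tower (quotient_tower G F1).
Proof.
intros HG H1; split.
- induction j as [|j IH]; intros v Hv; [now apply H1 |].
  apply (is_derive_ext (fun v => / INR (S j) * (G (S j) v - v * quotient_tower G F1 (S j) v))).
  { intros t; rewrite quotient_tower_SS; apply Rmult_comm. }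
  evar_last.
  + apply is_derive_scal.
    apply (is_derive_minus (V := R_NormedModule) (G (S j)) (fun v => v * quotient_tower G F1 (S j) v)).
    * now apply HG.
    * apply (is_derive_mult (K := R_AbsRing) (fun v => v) (quotient_tower G F1 (S j)));
        [apply is_derive_id | now apply IH | exact Rmult_comm].
  + unfold minus, opp, plus, one, mult; simpl AbelianMonoid.sort; cbn -[quotient_tower INR].
    unfold mult; cbn -[quotient_tower INR].
    assert (HSj : INR (S j) <> 0) by (apply not_0_INR; lia).
    apply Rmult_eq_reg_l with (INR (S j)); [| assumption].
    rewrite <- Rmult_assoc, Rinv_r, Rmult_1_l by assumption.
    (* At level [0] the identity reads [G_0 = v F_0], which is the definition of [F_0]; above it is
       the recursion. *)
    destruct j as [|j].
    * simpl; field; lra.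
    * rewrite quotient_tower_SS.
      assert (INR (S j) <> 0) by (apply not_0_INR; lia).
      rewrite (S_INR (S j)); field; assumption.
- intros v Hv; simpl.
  apply (continuous_mult (K := R_AbsRing) (G O) Rinv).
  + now apply HG.
  + apply (ex_derive_continuous (V := R_NormedModule)); auto_derive; lra.
Qed.

(** Each level multiplies the preceding one by [v], which costs one degree in [1 + v]; the
    singularity [/ v] at [0] does not get worse. *)
Lemma quotient_tower_bound G F1 al C :
  (forall j, exists K, forall v, 0 < v -> Rabs (G j v) <= K * decay_bound al v) ->
  (forall v, 0 < v -> Rabs (F1 v) <= C * decay_bound al v) ->
  forall j, exists K, forall v, 0 < v ->
    Rabs (quotient_tower G F1 (S j) v) <= K * (1 + v) ^ j * decay_bound al v.
Proof.
intros HG H1; induction j as [|j [K HK]].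
- exists C; intros v Hv; specialize (H1 v Hv); simpl; lra.
- destruct (HG (S j)) as [K' HK'].
  exists (Rabs K' + Rabs K); intros v Hv; rewrite quotient_tower_SS.
  specialize (HK v Hv); specialize (HK' v Hv).
  pose proof (decay_bound_pos al v Hv) as HB.
  assert (Hj : 1 <= INR (S j)) by (rewrite S_INR; pose proof (pos_INR j); lra).
  assert (Hp : 1 <= (1 + v) ^ j) by (apply pow_R1_Rle; lra).
  unfold Rdiv; rewrite Rabs_mult, (Rabs_pos_eq (/ _)) by (left; apply Rinv_0_lt_compat; lra).
  apply Rle_trans with (Rabs (G (S j) v - v * quotient_tower G F1 (S j) v) * 1).
  { apply Rmult_le_compat_l; [apply Rabs_pos |].
    rewrite <- Rinv_1; apply Rinv_le_contravar; lra. }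
  rewrite Rmult_1_r.
  apply Rle_trans with (1 := Rabs_triang _ _).
  rewrite Rabs_Ropp, Rabs_mult, (Rabs_pos_eq v) by lra.
  assert (Rabs (G (S j) v) <= Rabs K' * (1 + v) ^ S j * decay_bound al v).
  { apply Rle_trans with (1 := HK').
    apply Rmult_le_compat_r; [lra |].
    apply Rle_trans with (Rabs K'); [apply Rle_abs |].
    rewrite <- (Rmult_1_r (Rabs K')) at 1; apply Rmult_le_compat_l; [apply Rabs_pos |].
    apply pow_R1_Rle; lra. }
  assert (v * Rabs (quotient_tower G F1 (S j) v) <= Rabs K * (1 + v) ^ S j * decay_bound al v).
  { apply Rle_trans with ((1 + v) * (Rabs K * (1 + v) ^ j * decay_bound al v)).
    - apply Rmult_le_compat; [lra | apply Rabs_pos | lra |].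
      apply Rle_trans with (1 := HK); apply Rmult_le_compat_r; [lra |].
      apply Rmult_le_compat_r; [lra | apply Rle_abs].
    - simpl; lra. }
  lra.
Qed.

(** * The iterated integral *)

Lemma is_RInt_gen_sum_n_m (Fa Fb : (R -> Prop) -> Prop) {FFa : Filter Fa} {FFb : Filter Fb}
  (f : nat -> R -> R) (l : nat -> R) (a b : nat) :
  (forall k, (a <= k <= b)%nat -> is_RInt_gen (f k) Fa Fb (l k)) ->
  is_RInt_gen (fun x => sum_n_m (fun k => f k x) a b) Fa Fb (sum_n_m l a b).
Proof.
assert (H0 : is_RInt_gen (fun _ => 0) Fa Fb 0).
{ generalize (is_RInt_gen_antiderivative (fun _ => True) Fa Fb (fun _ => 0) (fun _ => 0) 0 0).
  rewrite Rminus_0_r; intros H; apply H; trivial; try apply filter_true; try apply filterlim_const; intros x _.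
  - apply (is_derive_const (V := R_NormedModule)).
  - apply continuous_const. }
induction b as [|b IH]; intros H.
- destruct a as [|a].
  + rewrite sum_n_n.
    apply (is_RInt_gen_ext (f O)); [| apply H; lia].
    apply filter_forall; intros; now rewrite sum_n_n.
  + rewrite sum_n_m_zero by lia.
    apply (is_RInt_gen_ext (fun _ => 0)); [| exact H0].
    apply filter_forall; intros; now rewrite sum_n_m_zero by lia.
- destruct (Compare_dec.le_lt_dec a (S b)) as [Hab | Hab].
  + rewrite sum_n_Sm by assumption.
    apply (is_RInt_gen_ext (fun x => plus (sum_n_m (fun k => f k x) a b) (f (S b) x))).
    { apply filter_forall; intros; now rewrite sum_n_Sm by assumption. }
    apply (is_RInt_gen_plus (V := R_NormedModule)); [apply IH; intros; apply H; lia | apply H; lia].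
  + rewrite sum_n_m_zero by lia.
    apply (is_RInt_gen_ext (fun _ => 0)); [| exact H0].
    apply filter_forall; intros; now rewrite sum_n_m_zero by lia.
Qed.

Lemma is_RInt_gen_unit_ext (f g : R -> R) l :
  (forall x, 0 < x < 1 -> f x = g x) ->
  is_RInt_gen f (at_right 0) (at_left 1) l -> is_RInt_gen g (at_right 0) (at_left 1) l.
Proof.
intros Hfg; apply (is_RInt_gen_ext f g).
apply (Filter_prod _ _ _ _ _ at_right_0_unit at_left_1_unit); intros a b Ha Hb x; simpl.
unfold Rmin, Rmax; destruct (Rle_dec a b); intros Hx; apply Hfg; lra.
Qed.

Lemma is_RInt_gen_eq (f : R -> R) l1 l2 :
  is_RInt_gen f (at_right 0) (at_left 1) l1 -> is_RInt_gen f (at_right 0) (at_left 1) l2 -> l1 = l2.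
Proof.
intros H1 H2.
rewrite <- (is_RInt_gen_unique (V := R_CompleteNormedModule) _ _ H1).
exact (is_RInt_gen_unique (V := R_CompleteNormedModule) _ _ H2).
Qed.

Lemma sum_n_m_Rmult_l (c : R) (f : nat -> R) a b :
  c * sum_n_m f a b = sum_n_m (fun k => c * f k) a b.
Proof. symmetry; exact (sum_n_m_mult_l (K := R_Ring) c f a b). Qed.

(** The real core of the theorem, applied once to the real and once to the imaginary part. The given
    inner and outer integrals are matched by uniqueness with those obtained by parts. *)
Lemma iterated_integral_of_tower G al s (Phi l : R) (f : R -> R -> R) (Iin : R -> R) (I : R) :
  0 < al -> (3 <= s)%nat -> primitive_tower G ->
  (forall j, exists K, forall v, 0 < v -> Rabs (G j v) <= K * decay_bound al v) ->
  filterlim (G s) (at_right 0) (locally Phi) ->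
  filterlim (G (s - 1)%nat) (at_right 0) (locally l) ->
  (forall x y, 0 < x < 1 -> 0 < y < 1 -> f x y =
     (-1) ^ s * (/ x * / y * (G O (- ln x + - ln y) / (- ln x + - ln y)) *
     sum_n_m (fun k => Binomial.C (s - 1) k * (- ln x) ^ k * (- ln y) ^ (s - k - 1)) 1 (s - 2))) ->
  (forall y, 0 < y < 1 -> is_RInt_gen (fun x => f x y) (at_right 0) (at_left 1) (Iin y)) ->
  is_RInt_gen Iin (at_right 0) (at_left 1) I ->
  I = (-1) ^ s * ((INR s - 2) * INR (fact (s - 1)) * (Phi / INR s)).
Proof.
intros Hal Hs HG HGb HGs HGl Hf HIin HI.
destruct (HGb O) as [K0 HK0].
destruct (primitive_vanishing_at_infinity al K0 (fun v => G O v / v)) as [F1 [C1 HF1]].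
{ assumption. }
{ intros v Hv; apply (continuous_mult (K := R_AbsRing) (G O) Rinv); [now apply HG |].
  apply (ex_derive_continuous (V := R_NormedModule)); auto_derive; lra. }
{ intros v Hv; unfold Rdiv; rewrite Rabs_mult, (Rabs_pos_eq (/ v)) by (left; now apply Rinv_0_lt_compat).
  apply Rmult_le_compat_r; [left; now apply Rinv_0_lt_compat | now apply HK0]. }
pose (F := quotient_tower G F1).
assert (HF : primitive_tower F) by (apply primitive_tower_quotient; [assumption | intros; now apply HF1]).
assert (HFb := quotient_tower_bound G F1 al C1 HGb (fun v Hv => proj2 (HF1 v Hv))); fold F in HFb.
assert (HFinf : forall i, rapid_decay (F (S i))).
{ intros i; destruct (HFb i) as [K HK]; now apply (rapid_decay_of_bound al K i). }
assert (HF2 : forall i j, (2 <= i)%nat -> filterlim (fun v => v ^ i * F (S j) v) (at_right 0) (locally 0)).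
{ intros i j Hi; destruct (HFb j) as [K HK]; now apply (filterlim_at_right_0_of_bound al K j). }
assert (Hid : filterlim (fun v => v) (at_right 0) (locally 0)).
{ apply (continuous_at_right (fun v => v)), continuous_id. }
(* The boundary term that [HF2] does not reach: [v F_s = (v G_(s-1) - v^2 F_(s-1)) / (s-1)], where
   [G_(s-1)] has a finite limit. *)
assert (HFs : filterlim (fun v => v ^ 1 * F s v) (at_right 0) (locally 0)).
{ destruct s as [|[|s']]; [lia | lia |].
  replace (S (S s') - 1)%nat with (S s') in HGl by lia.
  apply (filterlim_ext (fun v => / INR (S s') * (v * G (S s') v + -1 * (v ^ 2 * F (S s') v)))).
  { intros v; unfold F; rewrite quotient_tower_SS; unfold Rdiv; simpl pow; ring. }
  replace 0 with (/ INR (S s') * (0 * l + -1 * 0)) at 2 by ring.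
  apply filterlim_Rscal; [apply at_right_proper_filter |].
  apply filterlim_Rplus; [apply at_right_proper_filter | |].
  - apply filterlim_Rmult; [apply at_right_proper_filter | assumption | assumption].
  - apply filterlim_Rscal; [apply at_right_proper_filter |]; apply HF2; lia. }
(* Now [F_(s+1) = (G_s - v F_s) / s], and the second term has just been shown to vanish. *)
assert (HFS : filterlim (F (S s)) (at_right 0) (locally (Phi / INR s))).
{ destruct s as [|s']; [lia |].
  apply (filterlim_ext (fun v => / INR (S s') * (G (S s') v + -1 * (v ^ 1 * F (S s') v)))).
  { intros v; unfold F; rewrite quotient_tower_SS; unfold Rdiv; simpl pow; ring. }
  replace (Phi / INR (S s')) with (/ INR (S s') * (Phi + -1 * 0)) by (unfold Rdiv; ring).
  apply filterlim_Rscal; [apply at_right_proper_filter |].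
  apply filterlim_Rplus; [apply at_right_proper_filter | assumption |].
  now apply filterlim_Rscal; [apply at_right_proper_filter |]. }
assert (HIy : forall y, 0 < y < 1 -> Iin y =
   sum_n_m (fun k => ((-1) ^ s * / y * Binomial.C (s - 1) k * (- ln y) ^ (s - k - 1)) *
     (INR (fact k) * F (S k) (- ln y))) 1 (s - 2)).
{ intros y Hy; apply (is_RInt_gen_eq (fun x => f x y)); [now apply HIin |].
  apply (is_RInt_gen_unit_ext (fun x => sum_n_m (fun k =>
    ((-1) ^ s * / y * Binomial.C (s - 1) k * (- ln y) ^ (s - k - 1)) *
     (/ x * ((- ln x) ^ k * F O (- ln x + - ln y)))) 1 (s - 2))).
  - intros x Hx; rewrite Hf by assumption.
    rewrite <- Rmult_assoc, sum_n_m_Rmult_l; apply sum_n_m_ext; intros k; unfold F; simpl; ring.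
  - apply (is_RInt_gen_sum_n_m (at_right 0) (at_left 1)); intros k Hk.
    apply (is_RInt_gen_scal (V := R_NormedModule)).
    apply is_RInt_gen_inner; [assumption | assumption | now apply opp_ln_pos]. }
assert (Hfin : I = sum_n_m (fun k => ((-1) ^ s * Binomial.C (s - 1) k * INR (fact k)) *
     (INR (fact (s - k - 1)) * (Phi / INR s))) 1 (s - 2)).
{ apply (is_RInt_gen_eq Iin); [assumption |].
  apply (is_RInt_gen_unit_ext (fun y => sum_n_m (fun k =>
     ((-1) ^ s * Binomial.C (s - 1) k * INR (fact k)) *
     (/ y * ((- ln y) ^ (s - k - 1) * F (S k) (- ln y)))) 1 (s - 2))).
  - intros y Hy; rewrite HIy by assumption; apply sum_n_m_ext; intros k; simpl; ring.
  - apply (is_RInt_gen_sum_n_m (at_right 0) (at_left 1)); intros k Hk.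
    apply (is_RInt_gen_scal (V := R_NormedModule)).
    replace (S s) with (S k + (s - k - 1) + 1)%nat in HFS by lia.
    apply is_RInt_gen_outer; [assumption | assumption | | assumption].
    intros i Hi.
    destruct (Nat.eq_dec i 1) as [-> | Hi1].
    + now replace (S k + (s - k - 1) + 1 - 1)%nat with s by lia.
    + replace (S k + (s - k - 1) + 1 - i)%nat with (S (s - i)) by lia.
      apply HF2; lia. }
rewrite Hfin.
(* The factorials cancel the binomial: [C(s-1,k) k! (s-1-k)! = (s-1)!], so all [s - 2] terms are
   equal. *)
rewrite (sum_n_m_ext_loc _ (fun _ => (-1) ^ s * INR (fact (s - 1)) * (Phi / INR s))).
- rewrite sum_n_m_const; replace (S (s - 2) - 1)%nat with (s - 2)%nat by lia.
  rewrite minus_INR by lia; simpl (INR 2); ring.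
- intros k Hk; unfold Binomial.C.
  replace (s - 1 - k)%nat with (s - k - 1)%nat by lia.
  simpl; field; repeat split; try apply INR_fact_neq_0; apply not_0_INR; lia.
Qed.

(** * The power series [G_j] *)

Lemma cpown_Cpow w n : cpown w n = (w ^ n)%C.
Proof. induction n as [|n IH]; simpl; [reflexivity | now rewrite IH]. Qed.

Lemma Cmod_cpown w n : Cmod (cpown w n) = Cmod w ^ n.
Proof. rewrite cpown_Cpow; apply Cmod_pow. Qed.

Lemma Im_le_Cmod c : Rabs (Im c) <= Cmod c.
Proof. apply Rle_trans with (2 := Rmax_Cmod c), Rmax_r. Qed.

Lemma Cmod_shift_ge a k : 0 < Re a -> INR k + Re a <= Cmod (RtoC (INR k) + a).
Proof.
intros Ha; apply Rle_trans with (2 := re_le_Cmod _).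
apply Rle_trans with (2 := Rle_abs _); simpl; apply Rle_refl.
Qed.

Lemma shift_neq_0 (a : C) k : 0 < Re a -> (RtoC (INR k) + a)%C <> 0%C.
Proof.
intros Ha; apply Cmod_gt_0.
pose proof (Cmod_shift_ge a k Ha); pose proof (pos_INR k); lra.
Qed.

Lemma cpown_neq_0 (w : C) n : w <> 0%C -> cpown w n <> 0%C.
Proof.
intros Hw; apply Cmod_gt_0; rewrite Cmod_cpown; apply pow_lt; apply -> Cmod_gt_0; exact Hw.
Qed.

(** The factor [k + a] is the one that differentiating [exp (- (k + a) v)] brings down; this is why
    the series form a tower. *)
Lemma lerch_term_succ z j a k : 0 < Re a ->
  lerch_term z j a k = ((RtoC (INR k) + a) * lerch_term z (S j) a k)%C.
Proof.
intros Ha; unfold lerch_term; simpl cpown; field; split.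
- now apply cpown_neq_0, shift_neq_0.
- now apply shift_neq_0.
Qed.

Lemma Cmod_lerch_term_le z j a k : Cmod z <= 1 -> 0 < Re a ->
  Cmod (lerch_term z j a k) <= / Cmod (RtoC (INR k) + a) ^ j.
Proof.
intros Hz Ha; unfold lerch_term.
rewrite Cmod_div by now apply cpown_neq_0, shift_neq_0.
rewrite !Cmod_cpown; unfold Rdiv; rewrite <- Rmult_1_l; apply Rmult_le_compat_r.
- left; apply Rinv_0_lt_compat, pow_lt; apply -> Cmod_gt_0; now apply shift_neq_0.
- rewrite <- (pow1 k); apply pow_incr; split; [apply Cmod_ge_0 | assumption].
Qed.

Lemma Cmod_lerch_term_bound z j a k : Cmod z <= 1 -> 0 < Re a ->
  Cmod (lerch_term z j a k) <= / Re a ^ j.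
Proof.
intros Hz Ha; apply Rle_trans with (1 := Cmod_lerch_term_le z j a k Hz Ha).
apply Rinv_le_contravar; [now apply pow_lt |].
apply pow_incr; pose proof (Cmod_shift_ge a k Ha); pose proof (pos_INR k); lra.
Qed.

(** * Power series with bounded coefficients, Abel summation and absolute convergence *)

Lemma CV_radius_ge_1 b M : (forall n, Rabs (b n) <= M) -> Rbar_le 1 (CV_radius b).
Proof.
intros Hb; apply (CV_radius_bounded b); exists M; intros n.
rewrite pow1, Rmult_1_r; apply Hb.
Qed.

Lemma CV_radius_gt b M q : (forall n, Rabs (b n) <= M) -> 0 < q < 1 ->
  Rbar_lt (Rabs q) (CV_radius b).
Proof.
intros Hb Hq; apply Rbar_lt_le_trans with 1.
- simpl; rewrite Rabs_pos_eq; lra.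
- now apply (CV_radius_ge_1 b M).
Qed.

Lemma PSeries_bound b M q : (forall n, Rabs (b n) <= M) -> 0 < q < 1 ->
  Rabs (PSeries b q) <= M / (1 - q).
Proof.
intros Hb Hq.
assert (Hg : is_series (fun n => M * q ^ n) (M * / (1 - q))).
{ apply (is_series_scal_l (K := R_AbsRing) (V := R_NormedModule) M (fun n => q ^ n)), is_series_geom; rewrite Rabs_pos_eq; lra. }
assert (Hle : forall n, Rabs (b n * q ^ n) <= M * q ^ n).
{ intros n; rewrite Rabs_mult, (Rabs_pos_eq (q ^ n)) by (apply pow_le; lra).
  apply Rmult_le_compat_r; [apply pow_le; lra | apply Hb]. }
unfold PSeries; apply Rle_trans with (Series (fun n => Rabs (b n * q ^ n))).
- apply Series_Rabs.
  apply (CV_disk_inside b q); now apply (CV_radius_gt b M).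
- unfold Rdiv; rewrite <- (is_series_unique _ _ Hg); apply Series_le.
  + intros n; split; [apply Rabs_pos | apply Hle].
  + eexists; exact Hg.
Qed.

(** Bounded coefficients force a radius of at least [1]. Abel's theorem handles the radius exactly
    [1]; a larger one makes the sum continuous at [1]. *)
Lemma filterlim_PSeries_1 b M : (forall n, Rabs (b n) <= M) -> ex_series b ->
  filterlim (PSeries b) (at_left 1) (locally (Series b)).
Proof.
intros Hb Hex.
pose proof (CV_radius_ge_1 b M Hb) as Hr.
rewrite <- PSeries_1.
destruct (Rbar_le_lt_or_eq_dec _ _ Hr) as [Hlt | Heq].
- apply (filterlim_filter_le_1 (F := locally 1)); [apply filter_le_within |].
  apply continuity_pt_filterlim, PSeries_continuity; now rewrite Rabs_R1.
- assert (Habel := Abel b); rewrite <- Heq in Habel; simpl real in Habel; apply Habel.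
  + simpl; lra.
  + exact I.
  + apply (ex_series_ext b); [| assumption].
    intros n; rewrite pow_n_pow, pow1; symmetry; exact (scal_one (K := R_Ring) (V := R_ModuleSpace) (b n)).
Qed.

Lemma ex_series_inv_consecutive : ex_series (fun k => / (INR (S k) * INR (S (S k)))).
Proof.
exists 1.
apply (filterlim_ext (fun n => 1 - / INR (S (S n)))).
- induction x as [|n IH].
  + rewrite sum_O; simpl; field.
  + rewrite sum_Sn, <- IH; unfold plus; simpl AbelianMonoid.sort; cbn -[INR].
    rewrite (S_INR (S (S n))); assert (0 < INR (S (S n))) by (apply lt_0_INR; lia).
    field; lra.
- change (is_lim_seq (fun n => 1 - / INR (S (S n))) 1).
  replace (Finite 1) with (Finite (1 - 0)) by (f_equal; ring).
  apply (is_lim_seq_minus' (fun _ => 1) _ 1 0); [apply is_lim_seq_const |].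
  apply (is_lim_seq_ext (fun n => / INR (n + 2))); [intros n; now rewrite Nat.add_comm |].
  apply (is_lim_seq_incr_n (fun n => / INR n) 2).
  apply (is_lim_seq_inv _ p_infty); [apply is_lim_seq_INR | discriminate].
Qed.

(** With [m = min (Re a) 1] one has [|k + a| >= m (k + 1)], and [(k+1)^2 >= (k+1)(k+2)/2] leads to
    the telescoping series; the other [j - 2] powers are bounded below by [Re a ^ (j - 2)]. *)
Lemma ex_series_Cmod_lerch_term z j a : (2 <= j)%nat -> Cmod z <= 1 -> 0 < Re a ->
  ex_series (fun k => Cmod (lerch_term z j a k)).
Proof.
intros Hj Hz Ha.
set (m := Rmin (Re a) 1).
assert (Hm : 0 < m) by (apply Rmin_glb_lt; lra).
apply (ex_series_le (V := R_CompleteNormedModule) _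
  (fun k => 2 / (Re a ^ (j - 2) * m ^ 2) * / (INR (S k) * INR (S (S k))))).
- intros k; change (norm (Cmod (lerch_term z j a k))) with (Rabs (Cmod (lerch_term z j a k))).
  rewrite Rabs_pos_eq by apply Cmod_ge_0.
  apply Rle_trans with (1 := Cmod_lerch_term_le z j a k Hz Ha).
  pose proof (Cmod_shift_ge a k Ha) as Hk; pose proof (pos_INR k) as Hk0.
  set (r := Cmod (RtoC (INR k) + a)) in *.
  rewrite !S_INR.
  assert (Ham : 0 < Re a ^ (j - 2)) by now apply pow_lt.
  assert (Hm2 : 0 < m ^ 2) by now apply pow_lt.
  replace (2 / (Re a ^ (j - 2) * m ^ 2) * / ((INR k + 1) * (INR k + 1 + 1))) with
    (/ (Re a ^ (j - 2) * (m ^ 2 * ((INR k + 1) * (INR k + 1 + 1) / 2)))) by (field; lra).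
  apply Rinv_le_contravar.
  + repeat apply Rmult_lt_0_compat; lra.
  + replace (r ^ j) with (r ^ (j - 2) * r ^ 2) by (rewrite <- pow_add; f_equal; lia).
    apply Rmult_le_compat; [lra | | apply pow_incr; lra |].
    * apply Rmult_le_pos; [lra |]; apply Rle_mult_inv_pos; [apply Rmult_le_pos |]; lra.
    * assert (m * (INR k + 1) <= r).
      { pose proof (Rmin_l (Re a) 1 : m <= _); pose proof (Rmin_r (Re a) 1 : m <= _); nra. }
      apply Rle_trans with ((m * (INR k + 1)) ^ 2); [| apply pow_incr; nra].
      rewrite Rpow_mult_distr; apply Rmult_le_compat_l; [lra | nra].
- apply (ex_series_scal_l (K := R_AbsRing) (V := R_NormedModule) _ (fun k => / (INR (S k) * INR (S (S k))))); exact ex_series_inv_consecutive.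
Qed.

Definition lerch_re z j a q := PSeries (fun k => Re (lerch_term z j a k)) q.
Definition lerch_im z j a q := PSeries (fun k => Im (lerch_term z j a k)) q.

(* Real and imaginary part of [sum_k z^k exp (- (k + a) v) / (k + a)^j]. *)
Definition gen_re (z a : C) (j : nat) (v : R) : R :=
  exp (- (Re a * v)) * (cos (Im a * v) * lerch_re z j a (exp (- v))
                        + sin (Im a * v) * lerch_im z j a (exp (- v))).
Definition gen_im (z a : C) (j : nat) (v : R) : R :=
  exp (- (Re a * v)) * (cos (Im a * v) * lerch_im z j a (exp (- v))
                        - sin (Im a * v) * lerch_re z j a (exp (- v))).

Lemma Re_lerch_term_bound z j a : Cmod z <= 1 -> 0 < Re a ->
  forall k, Rabs (Re (lerch_term z j a k)) <= / Re a ^ j.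
Proof.
intros Hz Ha k; apply Rle_trans with (1 := re_le_Cmod _); now apply Cmod_lerch_term_bound.
Qed.

Lemma Im_lerch_term_bound z j a : Cmod z <= 1 -> 0 < Re a ->
  forall k, Rabs (Im (lerch_term z j a k)) <= / Re a ^ j.
Proof.
intros Hz Ha k; apply Rle_trans with (1 := Im_le_Cmod _); now apply Cmod_lerch_term_bound.
Qed.

(** * The generating functions [G_j] as towers of primitives *)

Lemma exp_opp_unit v : 0 < v -> 0 < exp (- v) < 1.
Proof.
intros Hv; split; [apply exp_pos |]; rewrite <- exp_0; apply exp_increasing; lra.
Qed.

(** The operator [q d/dq] multiplies the coefficient of index [k] by [k]; the zero put in front by
    [PS_incr_1] is the coefficient [0 * b 0]. *)
Lemma PSeries_euler (b : nat -> R) q :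
  Rbar_lt (Rabs q) (CV_radius b) ->
  q * PSeries (PS_derive b) q = PSeries (fun k => INR k * b k) q /\
  ex_pseries (fun k => INR k * b k) q.
Proof.
intros Hq.
assert (Hext : forall k, PS_incr_1 (PS_derive b) k = INR k * b k).
{ intros [|k]; [simpl; unfold zero; simpl; ring | reflexivity]. }
split.
- rewrite <- PSeries_incr_1; now apply PSeries_ext.
- apply (ex_pseries_ext (PS_incr_1 (PS_derive b))); [exact Hext |].
  apply ex_pseries_incr_1, ex_pseries_derive; assumption.
Qed.

Lemma PSeries_lin3 (a b c d : nat -> R) (la lb q : R) :
  ex_pseries a q -> ex_pseries b q -> ex_pseries c q ->
  (forall k, d k = c k + la * a k + lb * b k) ->
  PSeries d q = PSeries c q + la * PSeries a q + lb * PSeries b q.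
Proof.
intros Ha Hb Hc Hd.
assert (Hs : forall l (e : nat -> R), ex_pseries e q -> ex_pseries (PS_scal l e) q).
{ intros l e He; apply (ex_pseries_scal (K := R_AbsRing) (V := R_NormedModule)); [apply Rmult_comm | exact He]. }
rewrite <- !PSeries_scal, <- PSeries_plus, <- PSeries_plus; auto.
- apply PSeries_ext; exact Hd.
- apply (ex_pseries_plus (K := R_AbsRing) (V := R_NormedModule)); auto.
Qed.

(** Multiplying coefficients by [k + a] is the operator [q d/dq + a]; the last two equations are its
    real and imaginary part. *)
Lemma lerch_derive z j a q : Cmod z <= 1 -> 0 < Re a -> 0 < q < 1 ->
  exists dr di,
    is_derive (lerch_re z (S j) a) q dr /\ is_derive (lerch_im z (S j) a) q di /\
    lerch_re z j a q = q * dr + Re a * lerch_re z (S j) a q - Im a * lerch_im z (S j) a q /\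
    lerch_im z j a q = q * di + Re a * lerch_im z (S j) a q + Im a * lerch_re z (S j) a q.
Proof.
intros Hz Ha Hq.
pose proof (CV_radius_gt _ _ q (Re_lerch_term_bound z (S j) a Hz Ha) Hq) as Hr.
pose proof (CV_radius_gt _ _ q (Im_lerch_term_bound z (S j) a Hz Ha) Hq) as Hi.
destruct (PSeries_euler _ _ Hr) as [Er Xr]; destruct (PSeries_euler _ _ Hi) as [Ei Xi].
exists (PSeries (PS_derive (fun k => Re (lerch_term z (S j) a k))) q),
       (PSeries (PS_derive (fun k => Im (lerch_term z (S j) a k))) q).
split; [now apply is_derive_PSeries |]; split; [now apply is_derive_PSeries |].
rewrite Er, Ei; unfold lerch_re, lerch_im; split.
- unfold Rminus; rewrite Ropp_mult_distr_l; apply PSeries_lin3; try assumption; try now apply CV_radius_inside.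
  intros k; rewrite (lerch_term_succ z j a k Ha); generalize (lerch_term z (S j) a k) (INR k); intros t r.
  unfold Re, Im; simpl; ring.
- apply PSeries_lin3; try assumption; try now apply CV_radius_inside.
  intros k; rewrite (lerch_term_succ z j a k Ha); generalize (lerch_term z (S j) a k) (INR k); intros t r.
  unfold Re, Im; simpl; ring.
Qed.

Lemma is_derive_comp_exp_opp (f : R -> R) v d : is_derive f (exp (- v)) d ->
  is_derive (fun v => f (exp (- v))) v (- exp (- v) * d).
Proof.
intros Hf; apply (is_derive_comp f (fun v => exp (- v))); [assumption |].
auto_derive; [trivial | ring].
Qed.

Lemma is_derive_gen (P Q : R -> R) (al be v dP dQ : R) :
  is_derive P v dP -> is_derive Q v dQ ->
  is_derive (fun v => exp (- (al * v)) * (cos (be * v) * P v + sin (be * v) * Q v)) v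
    (exp (- (al * v)) * (cos (be * v) * (dP - al * P v + be * Q v)
                         + sin (be * v) * (dQ - al * Q v - be * P v))).
Proof.
intros HP HQ.
auto_derive.
- repeat split; [now exists dP | now exists dQ].
- replace (Derive (fun x => P x) v) with dP by (symmetry; now apply is_derive_unique).
  replace (Derive (fun x => Q x) v) with dQ by (symmetry; now apply is_derive_unique).
  ring.
Qed.

(** Multiplying the series by [- i] exchanges the pair (re, im) for (im, - re), so results on the
    shape [cos * P + sin * Q] cover both parts. *)
Lemma gen_im_eq z a j v : gen_im z a j v =
  exp (- (Re a * v)) * (cos (Im a * v) * lerch_im z j a (exp (- v))
                        + sin (Im a * v) * - lerch_re z j a (exp (- v))).
Proof. unfold gen_im; ring. Qed.

Lemma primitive_tower_gen_re z a : Cmod z <= 1 -> 0 < Re a -> primitive_tower (gen_re z a).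
Proof.
intros Hz Ha; split.
- intros j v Hv.
  destruct (lerch_derive z j a (exp (- v)) Hz Ha (exp_opp_unit v Hv)) as (dr & di & Hr & Hi & Er & Ei).
  evar_last.
  + apply is_derive_gen; apply is_derive_comp_exp_opp; eassumption.
  + unfold gen_re; rewrite Er, Ei; ring.
- intros v Hv; apply (ex_derive_continuous (V := R_NormedModule)); eexists.
  apply is_derive_gen; apply is_derive_comp_exp_opp; apply is_derive_PSeries;
    eapply CV_radius_gt; [now apply Re_lerch_term_bound | now apply exp_opp_unit
      | now apply Im_lerch_term_bound | now apply exp_opp_unit].
Qed.

Lemma primitive_tower_gen_im z a : Cmod z <= 1 -> 0 < Re a -> primitive_tower (gen_im z a).
Proof.
intros Hz Ha; split.
- intros j v Hv.
  destruct (lerch_derive z j a (exp (- v)) Hz Ha (exp_opp_unit v Hv)) as (dr & di & Hr & Hi & Er & Ei).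
  apply (is_derive_ext (fun v => exp (- (Re a * v)) * (cos (Im a * v) * lerch_im z (S j) a (exp (- v))
                        + sin (Im a * v) * - lerch_re z (S j) a (exp (- v))))).
  { intros t; symmetry; apply gen_im_eq. }
  evar_last.
  + apply is_derive_gen; [| apply (is_derive_opp (V := R_NormedModule) (fun v => lerch_re z (S j) a (exp (- v))))];
      apply is_derive_comp_exp_opp; eassumption.
  + unfold gen_im; rewrite Er, Ei; unfold opp; simpl; ring.
- intros v Hv.
  apply (continuous_ext (fun v => exp (- (Re a * v)) * (cos (Im a * v) * lerch_im z 0 a (exp (- v))
                        + sin (Im a * v) * - lerch_re z 0 a (exp (- v))))).
  { intros t; symmetry; apply gen_im_eq. }
  apply (ex_derive_continuous (V := R_NormedModule)); eexists.
  apply is_derive_gen; [| apply (is_derive_opp (V := R_NormedModule) (fun v => lerch_re z 0 a (exp (- v))))];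
    apply is_derive_comp_exp_opp; apply is_derive_PSeries;
    eapply CV_radius_gt; [now apply Im_lerch_term_bound | now apply exp_opp_unit
      | now apply Re_lerch_term_bound | now apply exp_opp_unit].
Qed.

(** * The integrand *)

(** From [exp v >= 1 + v] comes [1 - exp (- v) >= v / (1 + v)]. *)
Lemma inv_one_minus_exp_le v : 0 < v -> / (1 - exp (- v)) <= 1 + / v.
Proof.
intros Hv.
pose proof (exp_opp_unit v Hv) as He.
assert (H1 : (1 + v) * exp (- v) <= 1).
{ replace 1 with (exp v * exp (- v)) at 2 by (rewrite <- exp_plus, Rplus_opp_r; apply exp_0).
  apply Rmult_le_compat_r; [lra |]; apply exp_ineq1_le. }
replace (1 + / v) with (/ (v / (1 + v))) by (field; lra).
apply Rinv_le_contravar; [apply Rdiv_lt_0_compat; lra |].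
apply (Rmult_le_reg_r (1 + v)); [lra |].
replace (v / (1 + v) * (1 + v)) with v by (field; lra); lra.
Qed.

Lemma trig_combination_bound (c s p q B : R) :
  -1 <= c <= 1 -> -1 <= s <= 1 -> Rabs p <= B -> Rabs q <= B -> Rabs (c * p + s * q) <= 2 * B.
Proof.
intros Hc Hs Hp Hq.
apply Rle_trans with (1 := Rabs_triang _ _); rewrite !Rabs_mult.
apply Rabs_le in Hc, Hs.
assert (Rabs c * Rabs p <= 1 * B) by (apply Rmult_le_compat; auto using Rabs_pos).
assert (Rabs s * Rabs q <= 1 * B) by (apply Rmult_le_compat; auto using Rabs_pos).
lra.
Qed.

Lemma exp_trig_bound (al be v p q M : R) : 0 < v -> 0 <= M ->
  Rabs p <= M / (1 - exp (- v)) -> Rabs q <= M / (1 - exp (- v)) ->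
  Rabs (exp (- (al * v)) * (cos (be * v) * p + sin (be * v) * q)) <= 2 * M * decay_bound al v.
Proof.
intros Hv HM Hp Hq.
rewrite Rabs_mult, (Rabs_pos_eq (exp _)) by (left; apply exp_pos).
unfold decay_bound.
replace (2 * M * (exp (- (al * v)) * (1 + / v))) with (exp (- (al * v)) * (2 * (M * (1 + / v)))) by ring.
apply Rmult_le_compat_l; [left; apply exp_pos |].
assert (HB : M / (1 - exp (- v)) <= M * (1 + / v)).
{ apply Rmult_le_compat_l; [assumption | now apply inv_one_minus_exp_le]. }
apply trig_combination_bound; [apply COS_bound | apply SIN_bound | lra | lra].
Qed.

Lemma gen_re_bound z a j : Cmod z <= 1 -> 0 < Re a ->
  exists K, forall v, 0 < v -> Rabs (gen_re z a j v) <= K * decay_bound (Re a) v.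
Proof.
intros Hz Ha; exists (2 * / Re a ^ j); intros v Hv; apply exp_trig_bound; [assumption | | |].
- left; now apply Rinv_0_lt_compat, pow_lt.
- apply PSeries_bound; [now apply Re_lerch_term_bound | now apply exp_opp_unit].
- apply PSeries_bound; [now apply Im_lerch_term_bound | now apply exp_opp_unit].
Qed.

Lemma gen_im_bound z a j : Cmod z <= 1 -> 0 < Re a ->
  exists K, forall v, 0 < v -> Rabs (gen_im z a j v) <= K * decay_bound (Re a) v.
Proof.
intros Hz Ha; exists (2 * / Re a ^ j); intros v Hv; rewrite gen_im_eq; apply exp_trig_bound; [assumption | | |].
- left; now apply Rinv_0_lt_compat, pow_lt.
- apply PSeries_bound; [now apply Im_lerch_term_bound | now apply exp_opp_unit].
- rewrite Rabs_Ropp; apply PSeries_bound; [now apply Re_lerch_term_bound | now apply exp_opp_unit].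
Qed.

(** * Limits of the generating functions at [0+] *)

Lemma filterlim_exp_opp_0 : filterlim (fun v => exp (- v)) (at_right 0) (at_left 1).
Proof.
intros P [d Hd].
assert (Hc : continuous (fun v => exp (- v)) 0).
{ apply (ex_derive_continuous (V := R_NormedModule)); auto_derive; trivial. }
destruct (proj1 (filterlim_locally _ _) Hc d) as [e He].
exists e; intros v Hv H0; apply Hd.
- specialize (He v Hv); now rewrite Ropp_0, exp_0 in He.
- now apply exp_opp_unit.
Qed.

Lemma filterlim_exp_trig (al be : R) (p q : R -> R) lp lq :
  filterlim p (at_right 0) (locally lp) -> filterlim q (at_right 0) (locally lq) ->
  filterlim (fun v => exp (- (al * v)) * (cos (be * v) * p v + sin (be * v) * q v))
    (at_right 0) (locally lp).
Proof.
intros Hp Hq.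
assert (Hc : forall f : R -> R, ex_derive f 0 -> filterlim f (at_right 0) (locally (f 0))).
{ intros f Hf; now apply continuous_at_right, (ex_derive_continuous (V := R_NormedModule)). }
replace lp with (exp (- (al * 0)) * (cos (be * 0) * lp + sin (be * 0) * lq)).
2:{ rewrite !Rmult_0_r, Ropp_0, exp_0, cos_0, sin_0; ring. }
apply filterlim_Rmult; [apply at_right_proper_filter | |].
{ apply (Hc (fun v => exp (- (al * v)))); auto_derive; trivial. }
apply filterlim_Rplus; [apply at_right_proper_filter | |];
  (apply filterlim_Rmult; [apply at_right_proper_filter | | assumption]).
- apply (Hc (fun v => cos (be * v))); auto_derive; trivial.
- apply (Hc (fun v => sin (be * v))); auto_derive; trivial.
Qed.

Lemma filterlim_lerch_re z a j : (2 <= j)%nat -> Cmod z <= 1 -> 0 < Re a ->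
  filterlim (fun v => lerch_re z j a (exp (- v))) (at_right 0)
    (locally (Series (fun k => Re (lerch_term z j a k)))).
Proof.
intros Hj Hz Ha.
apply (filterlim_comp _ _ _ (fun v => exp (- v)) (lerch_re z j a) _ _ _ filterlim_exp_opp_0).
apply (filterlim_PSeries_1 _ _ (Re_lerch_term_bound z j a Hz Ha)).
apply (ex_series_le (V := R_CompleteNormedModule) _ (fun k => Cmod (lerch_term z j a k))).
- intros k; apply re_le_Cmod.
- now apply ex_series_Cmod_lerch_term.
Qed.

Lemma filterlim_lerch_im z a j : (2 <= j)%nat -> Cmod z <= 1 -> 0 < Re a ->
  filterlim (fun v => lerch_im z j a (exp (- v))) (at_right 0)
    (locally (Series (fun k => Im (lerch_term z j a k)))).
Proof.
intros Hj Hz Ha.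
apply (filterlim_comp _ _ _ (fun v => exp (- v)) (lerch_im z j a) _ _ _ filterlim_exp_opp_0).
apply (filterlim_PSeries_1 _ _ (Im_lerch_term_bound z j a Hz Ha)).
apply (ex_series_le (V := R_CompleteNormedModule) _ (fun k => Cmod (lerch_term z j a k))).
- intros k; apply Im_le_Cmod.
- now apply ex_series_Cmod_lerch_term.
Qed.

Lemma filterlim_gen_re z a j : (2 <= j)%nat -> Cmod z <= 1 -> 0 < Re a ->
  filterlim (gen_re z a j) (at_right 0) (locally (Re (LerchPhi z j a))).
Proof.
intros Hj Hz Ha; eapply filterlim_exp_trig; [now apply filterlim_lerch_re | now apply filterlim_lerch_im].
Qed.

Lemma filterlim_gen_im z a j : (2 <= j)%nat -> Cmod z <= 1 -> 0 < Re a ->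
  filterlim (gen_im z a j) (at_right 0) (locally (Im (LerchPhi z j a))).
Proof.
intros Hj Hz Ha.
apply (filterlim_ext (fun v => exp (- (Re a * v)) * (cos (Im a * v) * lerch_im z j a (exp (- v))
                        + sin (Im a * v) * (-1 * lerch_re z j a (exp (- v)))))).
{ intros v; rewrite gen_im_eq; ring. }
eapply filterlim_exp_trig; [now apply filterlim_lerch_im |].
apply filterlim_Rscal; [apply at_right_proper_filter | now apply filterlim_lerch_re].
Qed.

(** * Closed form of [G_0] and of the integrand *)

(** At level [0] the series [P] is geometric: splitting off its first term gives [P = 1 + q z P],
    read on components. The equation also shows that [1 - z q] is nonzero. *)
Lemma lerch_geometric z a q : Cmod z <= 1 -> 0 < Re a -> 0 < q < 1 ->
  ((1 - z * RtoC q) * (lerch_re z 0 a q, lerch_im z 0 a q) = 1)%C.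
Proof.
intros Hz Ha Hq.
pose proof (CV_radius_inside _ _ (CV_radius_gt _ _ q (Re_lerch_term_bound z 0 a Hz Ha) Hq)) as Hr.
pose proof (CV_radius_inside _ _ (CV_radius_gt _ _ q (Im_lerch_term_bound z 0 a Hz Ha) Hq)) as Hi.
assert (H0 : forall k, lerch_term z 0 a k = cpown z k).
{ intros k; unfold lerch_term; simpl; field. }
assert (Hz0 : ex_pseries (fun _ : nat => 0) q).
{ apply CV_radius_inside; now rewrite CV_radius_const_0. }
assert (HPz : PSeries (fun _ : nat => 0) q = 0) by apply PSeries_const_0.
assert (Er : lerch_re z 0 a q = 1 + q * (0 + Re z * lerch_re z 0 a q + - Im z * lerch_im z 0 a q)).
{ unfold lerch_re at 1; rewrite PSeries_decr_1 by assumption; rewrite <- HPz.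
  unfold lerch_re, lerch_im; rewrite <- (PSeries_lin3 _ _ _ (PS_decr_1 (fun k => Re (lerch_term z 0 a k)))); try assumption.
  - now rewrite H0.
  - intros k; unfold PS_decr_1; rewrite !H0; simpl cpown; generalize (cpown z k); intros t.
    unfold Re, Im; simpl; ring. }
assert (Ei : lerch_im z 0 a q = 0 + q * (0 + Re z * lerch_im z 0 a q + Im z * lerch_re z 0 a q)).
{ unfold lerch_im at 1; rewrite PSeries_decr_1 by assumption; rewrite <- HPz at 2.
  unfold lerch_re, lerch_im; rewrite <- (PSeries_lin3 _ _ _ (PS_decr_1 (fun k => Im (lerch_term z 0 a k)))); try assumption.
  - now rewrite H0.
  - intros k; unfold PS_decr_1; rewrite !H0; simpl cpown; generalize (cpown z k); intros t.
    unfold Re, Im; simpl; ring. }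
set (p := lerch_re z 0 a q) in *; set (r := lerch_im z 0 a q) in *.
unfold Re, Im in *; apply injective_projections; simpl; lra.
Qed.

Lemma gen_0_closed z a v : Cmod z <= 1 -> 0 < Re a -> 0 < v ->
  (cexp (- a * RtoC v) / (1 - z * RtoC (exp (- v))))%C = (gen_re z a 0 v, gen_im z a 0 v).
Proof.
intros Hz Ha Hv.
assert (Hg := lerch_geometric z a _ Hz Ha (exp_opp_unit v Hv)).
set (d := (1 - z * RtoC (exp (- v)))%C) in *.
pose (p := (lerch_re z 0 a (exp (- v)), lerch_im z 0 a (exp (- v))) : C).
change (d * p = RtoC 1)%C in Hg.
assert (Hd : d <> RtoC 0).
{ intros Hd; rewrite Hd, Cmult_0_l in Hg; injection Hg; lra. }
replace (cexp (- a * RtoC v) / d)%C with (cexp (- a * RtoC v) * p)%C.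
- unfold gen_re, gen_im, p, cexp, Re, Im; apply injective_projections; simpl;
    replace (- fst a * v - - snd a * 0) with (- (fst a * v)) by ring;
    replace (- fst a * 0 + - snd a * v) with (- (snd a * v)) by ring;
    rewrite cos_neg, sin_neg; ring.
- unfold Cdiv; rewrite <- (Cmult_1_l (/ d)%C), <- Hg; field; assumption.
Qed.

Lemma cexp_plus x y : cexp (x + y) = (cexp x * cexp y)%C.
Proof.
unfold cexp, Re, Im; simpl; rewrite exp_plus, cos_plus, sin_plus.
apply injective_projections; simpl; ring.
Qed.

(** The [- 1] in the exponent yields [/ x * / y], exactly the Jacobians of the two logarithmic
    substitutions. *)
Lemma rcpow_mul x y a : 0 < x -> 0 < y ->
  rcpow (x * y) (a - 1) = (RtoC (/ x * / y) * cexp (- a * RtoC (- ln x + - ln y)))%C.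
Proof.
intros Hx Hy; unfold rcpow; rewrite ln_mult by assumption.
replace ((a - 1) * RtoC (ln x + ln y))%C with
  (RtoC (- (ln x + ln y)) + - a * RtoC (- ln x + - ln y))%C.
2:{ apply injective_projections; simpl; ring. }
rewrite cexp_plus; f_equal; unfold cexp; simpl.
rewrite cos_0, sin_0, Rmult_1_r, Rmult_0_r, Ropp_plus_distr, exp_plus, !exp_Ropp, !exp_ln by assumption.
reflexivity.
Qed.

Lemma sum_log_sign n (p q : R) (c : nat -> R) m : (m <= n)%nat ->
  sum_n_m (fun k => c k * p ^ k * q ^ (n - k)) 1 m =
  (-1) ^ n * sum_n_m (fun k => c k * (- p) ^ k * (- q) ^ (n - k)) 1 m.
Proof.
intros Hm; rewrite sum_n_m_Rmult_l; apply sum_n_m_ext_loc; intros k Hk; simpl.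
replace (- p) with (-1 * p) by ring; replace (- q) with (-1 * q) by ring.
rewrite !Rpow_mult_distr.
transitivity ((-1) ^ (n + (k + (n - k))) * (c k * p ^ k * q ^ (n - k))).
- replace (n + (k + (n - k)))%nat with (2 * n)%nat by lia; rewrite pow_1_even; ring.
- rewrite !pow_add; ring.
Qed.

(** Each term is homogeneous of degree [s - 1] in the logarithms, hence the sign [- (-1)^s]; the
    extra minus is later absorbed by [ln (x y) = - (u + v)], where [u = - ln x] and [v = - ln y]. *)
Lemma log_sum_flip s x y : (3 <= s)%nat ->
  sum_n_m (fun k => Binomial.C (s - 1) k * ln x ^ k * ln y ^ (s - k - 1)) 1 (s - 2) =
  - ((-1) ^ s *
     sum_n_m (fun k => Binomial.C (s - 1) k * (- ln x) ^ k * (- ln y) ^ (s - k - 1)) 1 (s - 2)).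
Proof.
intros Hs.
assert (Hp : (-1) ^ s = - (-1) ^ (s - 1)).
{ replace s with (S (s - 1)) at 1 by lia; simpl pow; ring. }
rewrite Hp, Ropp_mult_distr_l, Ropp_involutive.
rewrite (sum_n_m_ext _ (fun k => Binomial.C (s - 1) k * ln x ^ k * ln y ^ (s - 1 - k))).
2:{ intros k; now replace (s - k - 1)%nat with (s - 1 - k)%nat by lia. }
rewrite sum_log_sign by lia; f_equal; apply sum_n_m_ext; intros k.
now replace (s - k - 1)%nat with (s - 1 - k)%nat by lia.
Qed.

Lemma integrand34_eq z s a x y : (3 <= s)%nat -> Cmod z <= 1 -> 0 < Re a ->
  0 < x < 1 -> 0 < y < 1 ->
  integrand34 z s a x y =
    (RtoC ((-1) ^ s * (/ x * / y * / (- ln x + - ln y) *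
      sum_n_m (fun k => Binomial.C (s - 1) k * (- ln x) ^ k * (- ln y) ^ (s - k - 1)) 1 (s - 2)))%R
     * (gen_re z a 0 (- ln x + - ln y)%R, gen_im z a 0 (- ln x + - ln y)%R))%C.
Proof.
intros Hs Hz Ha Hx Hy; unfold integrand34.
pose proof (opp_ln_pos x Hx); pose proof (opp_ln_pos y Hy).
set (w := - ln x + - ln y) in *.
assert (Hw : 0 < w) by (unfold w; lra).
rewrite <- gen_0_closed by assumption.
rewrite rcpow_mul by lra; fold w.
replace (x * y) with (exp (- w)).
2:{ unfold w; rewrite Ropp_plus_distr, !Ropp_involutive, exp_plus, !exp_ln by lra; reflexivity. }
rewrite ln_exp.
assert (Hg := lerch_geometric z a _ Hz Ha (exp_opp_unit w Hw)).
set (d := (1 - z * RtoC (exp (- w)))%C) in *.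
assert (Hd : d <> RtoC 0).
{ intros Hd; rewrite Hd, Cmult_0_l in Hg; injection Hg; lra. }
rewrite log_sum_flip by assumption.
set (S := sum_n_m _ _ _).
rewrite !RtoC_mult, !RtoC_opp, !RtoC_mult, (RtoC_inv w) by lra.
field; split; [assumption |].
intros E; injection E; lra.
Qed.

(** * Necessary conditions for convergence *)

(** The function [exp (- v)] forms a constant tower, regular at [0], so the same integration by
    parts yields [n!]. *)
Lemma Gamma_INR n : Gamma (INR (S n)) = INR (fact n).
Proof.
unfold Gamma; apply (is_RInt_gen_unique (V := R_CompleteNormedModule)).
pose (F := fun (_ : nat) v => exp (- v)).
assert (HF : primitive_tower F).
{ split; [intros j v Hv; unfold F; auto_derive; [trivial | ring] |].
  intros v Hv; apply (ex_derive_continuous (V := R_NormedModule)); unfold F; auto_derive; trivial. }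
apply (is_RInt_gen_ext (fun t => t ^ n * F O (t + 0))).
- apply (Filter_prod _ _ _ (fun t => 0 < t) (fun t => 0 < t)); [apply at_right_gt | now exists 0 |].
  intros x y Hx Hy t Ht; simpl in Ht.
  assert (0 < Rmin x y) by (apply Rmin_glb_lt; lra).
  rewrite S_INR; replace (INR n + 1 - 1) with (INR n) by ring.
  rewrite Rpower_pow by lra; unfold F; now rewrite Rplus_0_r.
- replace (INR (fact n)) with (0 - - (INR (fact n) * 1)) by ring.
  apply (is_RInt_gen_antiderivative (fun t => 0 < t) _ _ (by_parts F 0 n 0)).
  + intros; lra.
  + apply at_right_gt.
  + now exists 0.
  + intros t Ht; apply is_derive_by_parts; [assumption | lra].
  + intros t Ht; apply continuous_pow_shift; [assumption | lra].
  + assert (Hc : forall i, filterlim (fun u => u ^ i * exp (- u)) (at_right 0) (locally (0 ^ i * exp (- 0)))).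
    { intros i; apply (continuous_at_right (fun u => u ^ i * exp (- u))).
      apply (ex_derive_continuous (V := R_NormedModule)); auto_derive; trivial. }
    apply filterlim_by_parts_0.
    * intros i Hi; specialize (Hc i); now rewrite pow_i, Rmult_0_l in Hc by lia.
    * specialize (Hc O); rewrite Ropp_0, exp_0, pow_O, Rmult_1_r in Hc; revert Hc.
      apply filterlim_ext; intros u; unfold F; simpl; ring.
  + apply filterlim_by_parts_infty; [lra |].
    intros i; apply (rapid_decay_of_bound 1 1 0); [lra |].
    intros v Hv; unfold F, decay_bound; rewrite Rabs_pos_eq by (left; apply exp_pos).
    rewrite pow_O, !Rmult_1_l; rewrite <- (Rmult_1_r (exp (- v))) at 1.
    apply Rmult_le_compat_l; [left; apply exp_pos |].
    pose proof (Rinv_0_lt_compat v Hv); lra.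
Qed.

Lemma ex_series_C_components (t : nat -> C) : ex_series t ->
  ex_series (fun k => Re (t k)) /\ ex_series (fun k => Im (t k)).
Proof.
intros [l Hl].
assert (Hsum : forall n, Re (sum_n t n) = sum_n (fun k => Re (t k)) n /\
                         Im (sum_n t n) = sum_n (fun k => Im (t k)) n).
{ induction n as [|n [IH1 IH2]]; [rewrite !sum_O; split; reflexivity |].
  rewrite !sum_Sn, <- IH1, <- IH2; split; reflexivity. }
split; [exists (Re l) | exists (Im l)]; apply filterlim_locally; intros eps;
  generalize (proj1 (filterlim_locally (F := eventually) (sum_n t) l) Hl eps);
  apply filter_imp; intros n Hn;
  [change (ball (Re l) eps (sum_n (fun k => Re (t k)) n)); rewrite <- (proj1 (Hsum n))
  | change (ball (Im l) eps (sum_n (fun k => Im (t k)) n)); rewrite <- (proj2 (Hsum n))]; apply Hn.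
Qed.

Lemma is_lim_seq_pow_1 (u : nat -> R) s : is_lim_seq u 1 -> is_lim_seq (fun n => u n ^ s) 1.
Proof.
intros Hu; induction s as [|s IH]; simpl; [apply is_lim_seq_const |].
replace (Finite 1) with (Finite (1 * 1)) by (f_equal; ring).
now apply is_lim_seq_mult'.
Qed.

(** The ratio of consecutive moduli tends to [|z|]; were it above [1], the terms could not tend to
    [0]. Nothing is assumed on the sign of [Re a]; nonvanishing of the denominators comes from
    excluding nonpositive integers. *)
Lemma Cmod_le_1_of_ex_series_lerch z s a :
  (forall n : nat, a <> RtoC (- INR n)) -> ex_series (lerch_term z s a) -> Cmod z <= 1.
Proof.
intros Ha Hex; apply Rnot_lt_le; intros Hz.
assert (Hd : forall k, (RtoC (INR k) + a)%C <> RtoC 0).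
{ intros k E; apply (Ha k); rewrite RtoC_opp, <- (Cplus_0_r (- _)), <- E; ring. }
pose (r := fun k => Cmod (RtoC (INR k) + a)).
assert (Hr : forall k, 0 < r k) by (intros k; now apply Cmod_gt_0).
pose (b := fun k => Cmod (lerch_term z s a k)).
assert (Hb : forall k, b k = Cmod z ^ k / r k ^ s).
{ intros k; unfold b, lerch_term; rewrite Cmod_div by now apply cpown_neq_0.
  now rewrite !Cmod_cpown. }
assert (Hlow : forall k, INR k - Cmod a <= r k).
{ intros k; pose proof (Cmod_triangle (RtoC (INR k) + a) (- a)) as Ht.
  replace (RtoC (INR k) + a + - a)%C with (RtoC (INR k)) in Ht by ring.
  rewrite Cmod_opp, Cmod_R, Rabs_pos_eq in Ht by apply pos_INR; unfold r; lra. }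
apply (not_ex_series_DAlembert b (Cmod z)).
- exact Hz.
- intros k; rewrite Hb; apply Rgt_not_eq, Rdiv_lt_0_compat; apply pow_lt; [lra | apply Hr].
- assert (Hratio : is_lim_seq (fun k => r k / r (S k)) 1).
  { assert (Hinf : is_lim_seq (fun k => / r (S k)) 0).
    { apply (is_lim_seq_incr_1 (fun k => / r k)).
      apply (is_lim_seq_inv _ p_infty); [| discriminate].
      apply (is_lim_seq_le_p_loc (fun k => INR k - Cmod a)).
      - exists O; intros n _; apply Hlow.
      - apply (is_lim_seq_minus _ _ p_infty (Cmod a) p_infty); [apply is_lim_seq_INR | apply is_lim_seq_const | reflexivity]. }
    (* By the triangle inequality consecutive [r k] differ by at most [1], while [r k] tends to
       infinity. *)
    apply (is_lim_seq_le_le (fun k => 1 - / r (S k)) _ (fun k => 1 + / r (S k))).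
    - intros k; assert (Hrr : Rabs (r k - r (S k)) <= 1).
      { assert (H1 : r k <= r (S k) + 1).
        { pose proof (Cmod_triangle (RtoC (INR (S k)) + a) (RtoC (-1))) as Ht.
          replace (RtoC (INR (S k)) + a + RtoC (-1))%C with (RtoC (INR k) + a)%C in Ht.
          - rewrite Cmod_R, Rabs_left in Ht by lra; unfold r; lra.
          - rewrite S_INR; apply injective_projections; simpl; ring. }
        assert (H2 : r (S k) <= r k + 1).
        { pose proof (Cmod_triangle (RtoC (INR k) + a) (RtoC 1)) as Ht.
          replace (RtoC (INR k) + a + RtoC 1)%C with (RtoC (INR (S k)) + a)%C in Ht.
          - rewrite Cmod_R, Rabs_R1 in Ht; unfold r; lra.
          - rewrite S_INR; apply injective_projections; simpl; ring. }
        apply Rabs_le; lra. }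
      apply Rabs_le_between in Hrr.
      pose proof (Hr (S k)) as Hp; pose proof (Rinv_0_lt_compat _ Hp) as Hi.
      replace (r k / r (S k)) with (1 + (r k - r (S k)) * / r (S k)) by (field; lra).
      split; nra.
    - replace (Finite 1) with (Finite (1 - 0)) by (f_equal; ring).
      apply is_lim_seq_minus'; [apply is_lim_seq_const | exact Hinf].
    - replace (Finite 1) with (Finite (1 + 0)) by (f_equal; ring).
      apply is_lim_seq_plus'; [apply is_lim_seq_const | exact Hinf]. }
  apply (is_lim_seq_ext (fun k => Cmod z * (r k / r (S k)) ^ s)).
  + intros k; rewrite !Hb.
    pose proof (Hr k); pose proof (Hr (S k)).
    assert (0 < r k ^ s) by now apply pow_lt.
    assert (0 < r (S k) ^ s) by now apply pow_lt.
    assert (0 < Cmod z ^ k) by (apply pow_lt; lra).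
    replace (Cmod z ^ S k / r (S k) ^ s / (Cmod z ^ k / r k ^ s)) with (Cmod z * (r k / r (S k)) ^ s).
    * rewrite Rabs_pos_eq; [reflexivity |].
      apply Rmult_le_pos; [lra | apply pow_le; left; now apply Rdiv_lt_0_compat].
    * unfold Rdiv at 1; rewrite Rpow_mult_distr, pow_inv; simpl; field; lra.
  + replace (Finite (Cmod z)) with (Finite (Cmod z * 1)) by (f_equal; ring).
    apply is_lim_seq_mult'; [apply is_lim_seq_const | now apply is_lim_seq_pow_1].
- destruct (ex_series_C_components _ Hex) as [H1 H2].
  apply ex_series_lim_0 in H1; apply ex_series_lim_0 in H2.
  apply (is_lim_seq_le_le (fun _ => 0) _
    (fun k => Rabs (Re (lerch_term z s a k)) + Rabs (Im (lerch_term z s a k)))).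
  + intros k; split; [apply Cmod_ge_0 |]; unfold b.
    generalize (lerch_term z s a k); intros t.
    assert (Et : t = (RtoC (Re t) + Ci * RtoC (Im t))%C).
    { apply injective_projections; unfold Re, Im; simpl; ring. }
    rewrite Et at 1; apply Rle_trans with (1 := Cmod_triangle _ _).
    rewrite Cmod_mult, Cmod_Ci, !Cmod_R; lra.
  + apply is_lim_seq_const.
  + replace (Finite 0) with (Finite (0 + 0)) by (f_equal; ring).
    apply is_lim_seq_plus'; [now apply (is_lim_seq_abs_0 (fun k => Re (lerch_term z s a k)))
                              | now apply (is_lim_seq_abs_0 (fun k => Im (lerch_term z s a k)))].
Qed.

Lemma is_RInt_gen_C_components (f : R -> C) (l : C) :
  is_RInt_gen f (at_right 0) (at_left 1) l ->
  is_RInt_gen (fun x => Re (f x)) (at_right 0) (at_left 1) (Re l) /\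
  is_RInt_gen (fun x => Im (f x)) (at_right 0) (at_left 1) (Im l).
Proof.
intros H; split; intros P [eps HP];
  (assert (HQ : locally l (fun z : C => ball (fst l) eps (fst z) /\ ball (snd l) eps (snd z)))
    by (exists eps; intros z Hz; exact Hz));
  generalize (H _ HQ); unfold filtermapi; apply filter_imp; intros ab (v & Hv & Hb1 & Hb2).
- exists (Re v); split; [exact (is_RInt_fct_extend_fst _ _ _ _ Hv) | now apply HP].
- exists (Im v); split; [exact (is_RInt_fct_extend_snd _ _ _ _ Hv) | now apply HP].
Qed.

(** * Convergence of the inner integral at [0] and the sign of [Re a] *)

Lemma is_RInt_gen_cauchy_0 (f : R -> R) l eps : 0 < eps ->
  is_RInt_gen f (at_right 0) (at_left 1) l ->
  exists d, 0 < d /\ forall x1 x2, 0 < x1 < d -> 0 < x2 < d ->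
    exists J, is_RInt f x1 x2 J /\ Rabs J <= eps.
Proof.
intros Heps H.
assert (He2 : 0 < eps / 2) by lra.
assert (HQ : locally l (fun v => Rabs (v - l) < eps / 2)).
{ now exists (mkposreal _ He2). }
destruct (H _ HQ) as [Q S HQ0 HS HQS].
destruct (filter_ex _ HS) as [b Sb].
destruct HQ0 as [d Hd]; exists d; split; [apply cond_pos |].
assert (HQx : forall x, 0 < x < d -> Q x).
{ intros x Hx; apply Hd; [| lra]; change (Rabs (x - 0) < d); rewrite Rminus_0_r, Rabs_pos_eq; lra. }
intros x1 x2 H1 H2.
destruct (HQS x1 b (HQx x1 H1) Sb) as (v1 & I1 & B1).
destruct (HQS x2 b (HQx x2 H2) Sb) as (v2 & I2 & B2).
simpl in I1, I2.
exists (plus v1 (opp v2)); split.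
- apply (is_RInt_Chasles f x1 b x2); [assumption | now apply is_RInt_swap].
- change (Rabs (v1 + - v2) <= eps).
  apply Rabs_def2 in B1; apply Rabs_def2 in B2; apply Rabs_le; lra.
Qed.

Lemma cos_ge_half th : Rabs th <= 1 -> / 2 <= cos th.
Proof.
intros Hth.
assert (Hc : cos th = cos (Rabs th)).
{ unfold Rabs; destruct (Rcase_abs th); [now rewrite cos_neg | reflexivity]. }
(* This gives [3 / 2 < PI / 2], hence [1 < PI / 3]. *)
pose proof PI2_3_2.
rewrite Hc; replace (/ 2) with (cos (PI / 3)) by (rewrite cos_PI3; field).
pose proof (Rabs_pos th).
destruct (Req_dec (Rabs th) (PI / 3)) as [-> | Hne]; [apply Rle_refl |].
left; apply cos_decreasing_1; lra.
Qed.

(** After multiplying by the conjugate of [1 - w], the numerator is at least [1/2 - 1/4] and the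
    denominator [|1 - w|^2] at most [(5/4)^2]; the quotient [4/25] exceeds [1/10]. *)
Lemma Re_unit_div_ge th (w : C) : / 2 <= cos th -> Cmod w <= / 4 ->
  / 10 <= Re ((cos th, sin th) / (1 - w))%C.
Proof.
intros Hc Hw.
assert (Hw2 : fst w ^ 2 + snd w ^ 2 <= / 16).
{ replace (/ 16) with ((/ 4) ^ 2) by field.
  assert (H2 := Cmod2_alt w); unfold Re, Im in H2.
  rewrite <- H2; apply pow_incr; split; [apply Cmod_ge_0 | assumption]. }
destruct w as [p q]; simpl in Hw2.
pose proof (sin2_cos2 th) as Hsc; unfold Rsqr in Hsc.
set (c := cos th) in *; set (s := sin th) in *.
assert (Hpq : (c * p + s * q) ^ 2 <= (/ 4) ^ 2).
{ assert (0 <= (c * q - s * p) ^ 2) by apply pow2_ge_0.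
  assert ((c * p + s * q) ^ 2 + (c * q - s * p) ^ 2 = (s * s + c * c) * (p ^ 2 + q ^ 2)) by ring.
  rewrite Hsc in *; simpl in *; lra. }
assert (Hpq' : c * p + s * q <= / 4).
{ apply Rnot_lt_le; intros Hn; assert ((/ 4) ^ 2 < (c * p + s * q) ^ 2); [| lra].
  simpl; rewrite !Rmult_1_r; apply Rmult_gt_0_lt_compat; lra. }
assert (Hp : - / 4 <= p <= / 4) by (split; nra).
unfold Re; simpl.
match goal with |- context [_ / ?d] => set (D := d) end.
assert (HD : D = 1 - 2 * p + (p ^ 2 + q ^ 2)) by (unfold D; ring).
assert (HD1 : 0 < D) by (rewrite HD; nra).
assert (HD2 : D <= 25 / 16) by (rewrite HD; simpl; lra).
replace (c * ((1 + - p) / D) - s * (- (0 + - q) / D)) with ((c - (c * p + s * q)) / D) by (field; lra).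
apply (Rmult_le_reg_r D); [assumption |].
unfold Rdiv; rewrite Rmult_assoc, Rinv_l by lra; lra.
Qed.

(** All terms are nonnegative, so the one with [k = 1] suffices; it is present because [s >= 3].
    Since [x <= y], the ratio [u / (u + v)] is at least [1/2]. *)
Lemma log_sum_lower s x y : (3 <= s)%nat -> 0 < y < 1 -> 0 < x <= y ->
  INR (s - 1) * (- ln y) ^ (s - 2) / 2 <=
  sum_n_m (fun k => Binomial.C (s - 1) k * (- ln x) ^ k * (- ln y) ^ (s - k - 1)) 1 (s - 2)
    / (- ln x + - ln y).
Proof.
intros Hs Hy Hx.
pose proof (opp_ln_pos y Hy) as Hv.
assert (Huv : - ln y <= - ln x).
{ apply Ropp_le_contravar; destruct (Req_dec x y) as [-> | Hn]; [apply Rle_refl |].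
  left; apply ln_increasing; lra. }
set (u := - ln x) in *; set (v := - ln y) in *.
assert (Hterm : forall k, 0 <= Binomial.C (s - 1) k * u ^ k * v ^ (s - k - 1)).
{ intros k; apply Rmult_le_pos; [apply Rmult_le_pos |]; try (apply pow_le; lra).
  unfold Binomial.C; apply Rle_mult_inv_pos; [apply pos_INR |].
  apply Rmult_lt_0_compat; apply INR_fact_lt_0. }
assert (Hsum : INR (s - 1) * u * v ^ (s - 2) <=
   sum_n_m (fun k => Binomial.C (s - 1) k * u ^ k * v ^ (s - k - 1)) 1 (s - 2)).
{ rewrite sum_Sn_m by lia.
  assert (H0 : 0 <= sum_n_m (fun k => Binomial.C (s - 1) k * u ^ k * v ^ (s - k - 1)) 2 (s - 2)).
  { replace 0 with (sum_n_m (fun _ => 0) 2 (s - 2)).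
    - apply sum_n_m_le; exact Hterm.
    - exact (sum_n_m_const_zero (G := R_AbelianMonoid) 2 (s - 2)). }
  assert (H1 : Binomial.C (s - 1) 1 = INR (s - 1)).
  { unfold Binomial.C; replace (s - 1)%nat with (S (s - 2)) by lia.
    replace (S (s - 2) - 1)%nat with (s - 2)%nat by lia.
    rewrite fact_simpl, mult_INR; simpl (fact 1); simpl (INR 1); field; apply INR_fact_neq_0. }
  unfold plus; simpl; rewrite H1, Rmult_1_r.
  replace (s - 1 - 1)%nat with (s - 2)%nat by lia; simpl in H0; lra. }
apply Rle_trans with (INR (s - 1) * u * v ^ (s - 2) / (u + v)).
- assert (HA : 0 <= INR (s - 1) * v ^ (s - 2)) by (apply Rmult_le_pos; [apply pos_INR | apply pow_le; lra]).
  replace (INR (s - 1) * v ^ (s - 2) / 2) with (INR (s - 1) * v ^ (s - 2) * / 2) by reflexivity.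
  replace (INR (s - 1) * u * v ^ (s - 2) / (u + v)) with (INR (s - 1) * v ^ (s - 2) * (u / (u + v))) by (field; lra).
  apply Rmult_le_compat_l; [assumption |].
  apply (Rmult_le_reg_r (u + v)); [lra |].
  unfold Rdiv; rewrite Rmult_assoc, Rinv_l by lra; lra.
- apply Rmult_le_compat_r; [left; apply Rinv_0_lt_compat; lra | exact Hsum].
Qed.

(* If [Re a <= 0], rotating by the phase at [x0] makes the integrand at least [c / x] on
   [[x0, lam x0]], so the inner integral violates the Cauchy criterion at [0]. *)
Lemma Re_pos_of_inner_integrable z s a (l : C) : (3 <= s)%nat -> Cmod z <= 1 ->
  is_RInt_gen (fun x => integrand34 z s a x (/ 2)) (at_right 0) (at_left 1) l ->
  0 < Re a.
Proof.
intros Hs Hz HI; apply Rnot_le_lt; intros Ha.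
set (y := / 2) in *.
assert (Hy : 0 < y < 1) by (unfold y; lra).
pose proof (opp_ln_pos y Hy) as Hv.
set (c0 := INR (s - 1) * (- ln y) ^ (s - 2) / 2).
assert (Hc0 : 0 < c0).
{ apply Rdiv_lt_0_compat; [| lra]; apply Rmult_lt_0_compat; [apply lt_0_INR; lia | now apply pow_lt]. }
set (be := Im a).
assert (Hbe : 0 < Rabs be + 1) by (pose proof (Rabs_pos be); lra).
(* On [[x0, lam x0]] the phase [be ln x] then varies by at most [|be| / (|be| + 1)], less than
   [1]. *)
set (lam := exp (/ (Rabs be + 1))).
assert (Hlam : 1 < lam).
{ rewrite <- exp_0; apply exp_increasing, Rinv_0_lt_compat; assumption. }
(* Length [(lam - 1) x0] times the lower bound [c0 / (10 lam x0)]: independent of [x0], so it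
   survives arbitrarily close to [0]. *)
set (eta := c0 * (lam - 1) / (10 * lam)).
assert (Heta : 0 < eta).
{ apply Rdiv_lt_0_compat; [apply Rmult_lt_0_compat |]; lra. }
destruct (is_RInt_gen_C_components _ _ HI) as [HIr HIi].
destruct (is_RInt_gen_cauchy_0 _ _ (eta / 4) ltac:(lra) HIr) as (d1 & Hd1 & HJ1).
destruct (is_RInt_gen_cauchy_0 _ _ (eta / 4) ltac:(lra) HIi) as (d2 & Hd2 & HJ2).
set (d := Rmin (Rmin d1 d2) y).
assert (Hd : 0 < d /\ d <= d1 /\ d <= d2 /\ d <= y).
{ unfold d; pose proof (Rmin_l (Rmin d1 d2) y); pose proof (Rmin_r (Rmin d1 d2) y).
  pose proof (Rmin_l d1 d2); pose proof (Rmin_r d1 d2).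
  repeat split; try lra; repeat apply Rmin_glb_lt; lra. }
set (x0 := d / (2 * lam)).
assert (Hx0 : 0 < x0) by (apply Rdiv_lt_0_compat; lra).
assert (Hlx : lam * x0 = d / 2) by (unfold x0; field; lra).
assert (Hxl : x0 < lam * x0) by nra.
destruct (HJ1 x0 (lam * x0)) as (J1 & IJ1 & BJ1); [lra | lra |].
destruct (HJ2 x0 (lam * x0)) as (J2 & IJ2 & BJ2); [lra | lra |].
set (th0 := be * ln (x0 * y)).
(* The combination with weights [wr], [wi] is the real part after removing the phase at [x0] and the
   sign [(-1)^s]. *)
set (wr := (-1) ^ s * cos th0); set (wi := (-1) ^ s * sin th0).
assert (Hsg : Rabs ((-1) ^ s) = 1) by apply pow_1_abs.
assert (Hg : is_RInt (fun x => wr * Re (integrand34 z s a x y) + wi * Im (integrand34 z s a x y))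
               x0 (lam * x0) (wr * J1 + wi * J2)).
{ apply (is_RInt_plus (V := R_NormedModule) (fun x => wr * Re (integrand34 z s a x y))
     (fun x => wi * Im (integrand34 z s a x y))); apply (is_RInt_scal (V := R_NormedModule)); assumption. }
assert (Hup : wr * J1 + wi * J2 <= eta / 2).
{ apply Rle_trans with (1 := Rle_abs _), Rle_trans with (1 := Rabs_triang _ _).
  unfold wr, wi; rewrite !Rabs_mult, Hsg, !Rmult_1_l.
  pose proof (Rabs_pos J1); pose proof (Rabs_pos J2).
  assert (Rabs (cos th0) <= 1) by (apply Rabs_le, COS_bound).
  assert (Rabs (sin th0) <= 1) by (apply Rabs_le, SIN_bound).
  nra. }
assert (Hlo : eta <= wr * J1 + wi * J2).
{ apply (is_RInt_le (fun _ => c0 / (10 * (lam * x0)))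
    (fun x => wr * Re (integrand34 z s a x y) + wi * Im (integrand34 z s a x y)) x0 (lam * x0)).
  - lra.
  - replace eta with (scal (lam * x0 - x0) (c0 / (10 * (lam * x0)))).
    + apply (is_RInt_const (V := R_NormedModule)).
    + unfold scal; simpl; unfold mult; simpl; unfold eta; field; lra.
  - exact Hg.
  - intros x Hx.
    assert (Hxy : 0 < x * y < 1) by nra.
    set (L := ln (x * y)).
    assert (HL : L < 0) by (pose proof (opp_ln_pos _ Hxy); unfold L; lra).
    set (S := sum_n_m (fun k => Binomial.C (s - 1) k * (- ln x) ^ k * (- ln y) ^ (s - k - 1)) 1 (s - 2)).
    assert (HS : c0 <= S / (- ln x + - ln y)) by (apply log_sum_lower; [assumption | assumption | lra]).
    assert (HLw : - ln x + - ln y = - L) by (unfold L; rewrite ln_mult by lra; ring).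
    rewrite HLw in HS.
    set (w := (z * RtoC (x * y))%C).
    assert (Hw : Cmod w <= / 4).
    { unfold w; rewrite Cmod_mult, Cmod_R, Rabs_pos_eq by lra.
      apply Rle_trans with (1 * (x * y)); [apply Rmult_le_compat_r; lra |]; unfold y in *; lra. }
    assert (Hth : Rabs (be * L - th0) <= 1).
    { unfold th0, L; rewrite <- Rmult_minus_distr_l, Rabs_mult.
      rewrite !ln_mult by lra.
      assert (H1 : ln x0 < ln x) by (apply ln_increasing; lra).
      assert (H2 : ln x < ln lam + ln x0) by (rewrite <- ln_mult by lra; apply ln_increasing; lra).
      replace (ln lam) with (/ (Rabs be + 1)) in H2 by (unfold lam; now rewrite ln_exp).
      rewrite (Rabs_pos_eq (_ - _)) by lra.
      apply Rle_trans with ((Rabs be + 1) * / (Rabs be + 1)).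
      - pose proof (Rabs_pos be); apply Rmult_le_compat; lra.
      - rewrite Rinv_r; lra. }
    pose proof (Re_unit_div_ge _ w (cos_ge_half _ Hth) Hw) as HR.
    assert (Hd0 : (1 - w)%C <> RtoC 0).
    { intros E0; assert (E1 : w = RtoC 1).
      { replace w with (1 - (1 - w))%C by ring; rewrite E0; ring. }
      rewrite E1, Cmod_1 in Hw; lra. }
    assert (Heq : wr * Re (integrand34 z s a x y) + wi * Im (integrand34 z s a x y) =
       S / - L * exp ((Re a - 1) * L) * Re ((cos (be * L - th0), sin (be * L - th0)) / (1 - w))%C).
    { assert (Hint : integrand34 z s a x y =
        (RtoC ((-1) ^ s * (S / - L * exp ((Re a - 1) * L))) * ((cos (be * L), sin (be * L)) / (1 - w)))%C).
      { unfold integrand34; fold L; fold w.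
        rewrite log_sum_flip by assumption; fold S.
        replace (rcpow (x * y) (a - 1)) with
          (RtoC (exp ((Re a - 1) * L)) * (cos (be * L), sin (be * L)))%C.
        - unfold Rdiv; rewrite !RtoC_mult, RtoC_inv, !RtoC_opp, RtoC_mult by lra.
          field; split; [assumption |]; intros E0; injection E0; lra.
        - unfold rcpow, cexp; fold L; unfold be, Re, Im; apply injective_projections; simpl;
          replace ((fst a + - (1)) * L - (snd a + - 0) * 0) with ((fst a - 1) * L) by ring;
          replace ((fst a + - (1)) * 0 + (snd a + - 0) * L) with (snd a * L) by ring; ring. }
      rewrite Hint; unfold wr, wi.
      rewrite cos_minus, sin_minus.
      assert (Hs1 : (-1) ^ s * (-1) ^ s = 1).
      { rewrite <- pow_add; replace (s + s)%nat with (2 * s)%nat by lia; apply pow_1_even. }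
      unfold Cdiv; generalize (/ (1 - w))%C; intros t; unfold Re, Im; simpl.
      set (T := S / - L * exp ((fst a - 1) * L)).
      transitivity (((-1) ^ s * (-1) ^ s) * (T * ((cos (be * L) * cos th0 + sin (be * L) * sin th0) * fst t
         - (sin (be * L) * cos th0 - cos (be * L) * sin th0) * snd t))); [ring | rewrite Hs1; ring]. }
    rewrite Heq.
    (* The assumption [Re a <= 0] acts here: [(x y)^(Re a - 1) >= / (x y) >= / x]. *)
    assert (Hexp : / x <= exp ((Re a - 1) * L)).
    { apply Rle_trans with (exp (- L)).
      - unfold L; rewrite exp_Ropp, exp_ln by lra.
        apply Rinv_le_contravar; nra.
      - destruct (Req_dec (- L) ((Re a - 1) * L)) as [<- | Hn]; [apply Rle_refl |].
        left; apply exp_increasing; nra. }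
    assert (Hxi : / (lam * x0) <= / x) by (apply Rinv_le_contravar; lra).
    assert (Hli : 0 < / (lam * x0)) by (apply Rinv_0_lt_compat; lra).
    replace (c0 / (10 * (lam * x0))) with (c0 * / (lam * x0) * / 10) by (field; lra).
    apply Rmult_le_compat; [apply Rmult_le_pos; lra | lra | | exact HR].
    apply Rmult_le_compat; lra. }
lra.
Qed.

Theorem theorem3p4 (z : C) (s : nat) (a : C) (Iin : R -> C) (I : C) :
  (2 <= s)%nat ->
  (* Phi(z,s,a) is defined: a is not a nonpositive integer and the series converges *)
  (forall n : nat, a <> RtoC (- INR n)) ->
  ex_series (lerch_term z s a) ->
  (* the (iterated, improper) integral converges, to I *)
  (forall y, 0 < y < 1 ->
     is_RInt_gen (fun x => integrand34 z s a x y) (at_right 0) (at_left 1) (Iin y)) ->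
  is_RInt_gen Iin (at_right 0) (at_left 1) I ->
  (RtoC ((INR s - 2) * (-1) ^ s / INR s) * LerchPhi z s a * RtoC (Gamma (INR s)))%C = I.
Proof.
intros Hs Ha Hex Hin Hout.
assert (Hin' := fun y Hy => is_RInt_gen_C_components _ _ (Hin y Hy)).
destruct (is_RInt_gen_C_components _ _ Hout) as [Hre Him].
(* For [s = 2] the sum runs from [1] to [0], so the integrand is [0] whatever its denominator, and
   the factor [s - 2] annihilates the other side. *)
destruct (Nat.eq_dec s 2) as [-> | Hs2].
{ assert (H0 : is_RInt_gen (fun _ => 0) (at_right 0) (at_left 1) 0).
  { apply (is_RInt_gen_unit_ext (fun x => sum_n_m (fun _ => 0) 1 0)).
    - intros; now rewrite sum_n_m_zero by lia.
    - generalize (is_RInt_gen_sum_n_m (at_right 0) (at_left 1) (fun _ _ => 0) (fun _ => 0) 1 0).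
      rewrite sum_n_m_zero by lia; intros H; apply H; lia. }
  assert (Hz0 : forall x y, integrand34 z 2 a x y = RtoC 0).
  { intros x y; unfold integrand34.
    rewrite sum_n_m_zero by lia; apply Cmult_0_r. }
  assert (HR : forall y, 0 < y < 1 -> 0 = Re (Iin y)).
  { intros y Hy; apply (is_RInt_gen_eq (fun _ => 0)); [exact H0 |].
    apply (is_RInt_gen_unit_ext (fun x => Re (integrand34 z 2 a x y))); [| exact (proj1 (Hin' y Hy))].
    intros x _; now rewrite Hz0. }
  assert (HM : forall y, 0 < y < 1 -> 0 = Im (Iin y)).
  { intros y Hy; apply (is_RInt_gen_eq (fun _ => 0)); [exact H0 |].
    apply (is_RInt_gen_unit_ext (fun x => Im (integrand34 z 2 a x y))); [| exact (proj2 (Hin' y Hy))].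
    intros x _; now rewrite Hz0. }
  replace ((INR 2 - 2) * (-1) ^ 2 / INR 2) with 0 by (simpl; field).
  rewrite !Cmult_0_l; apply injective_projections.
  - apply (is_RInt_gen_eq (fun _ => 0)); [exact H0 |].
    apply (is_RInt_gen_unit_ext (fun y => Re (Iin y))); [| exact Hre].
    intros y Hy; symmetry; now apply HR.
  - apply (is_RInt_gen_eq (fun _ => 0)); [exact H0 |].
    apply (is_RInt_gen_unit_ext (fun y => Im (Iin y))); [| exact Him].
    intros y Hy; symmetry; now apply HM. }
assert (Hs3 : (3 <= s)%nat) by lia.
assert (Hz := Cmod_le_1_of_ex_series_lerch z s a Ha Hex).
assert (Hpos : 0 < Re a) by (apply (Re_pos_of_inner_integrable z s a _ Hs3 Hz (Hin (/ 2) ltac:(lra)))).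
assert (HG : Gamma (INR s) = INR (fact (s - 1))).
{ replace s with (S (s - 1)) at 1 by lia; apply Gamma_INR. }
assert (Hsn : INR s <> 0) by (apply not_0_INR; lia).
assert (ER : Re I = (-1) ^ s * ((INR s - 2) * INR (fact (s - 1)) * (Re (LerchPhi z s a) / INR s))).
{ apply (iterated_integral_of_tower (gen_re z a) (Re a) s _ (Re (LerchPhi z (s - 1) a))
    (fun x y => Re (integrand34 z s a x y)) (fun y => Re (Iin y))); try assumption.
  - now apply primitive_tower_gen_re.
  - intros j; now apply gen_re_bound.
  - now apply filterlim_gen_re.
  - apply filterlim_gen_re; [lia | assumption | assumption].
  - intros x y Hx Hy; rewrite integrand34_eq by assumption.
    pose proof (opp_ln_pos x Hx); pose proof (opp_ln_pos y Hy).
    unfold Re at 1; simpl; field; lra.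
  - intros y Hy; exact (proj1 (Hin' y Hy)). }
assert (EI : Im I = (-1) ^ s * ((INR s - 2) * INR (fact (s - 1)) * (Im (LerchPhi z s a) / INR s))).
{ apply (iterated_integral_of_tower (gen_im z a) (Re a) s _ (Im (LerchPhi z (s - 1) a))
    (fun x y => Im (integrand34 z s a x y)) (fun y => Im (Iin y))); try assumption.
  - now apply primitive_tower_gen_im.
  - intros j; now apply gen_im_bound.
  - now apply filterlim_gen_im.
  - apply filterlim_gen_im; [lia | assumption | assumption].
  - intros x y Hx Hy; rewrite integrand34_eq by assumption.
    pose proof (opp_ln_pos x Hx); pose proof (opp_ln_pos y Hy).
    unfold Im at 1; simpl; field; lra.
  - intros y Hy; exact (proj2 (Hin' y Hy)). }
rewrite HG; apply injective_projections.
- change (fst I) with (Re I); rewrite ER; unfold Re; simpl; field; assumption.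
- change (snd I) with (Im I); rewrite EI; unfold Im; simpl; field; assumption.
Qed.
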